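(* Let $\lambda=(\lambda_1,\ldots,\lambda_r)$ with $\lambda_1>\cdots>\lambda_r\ge 0$ and $\mu=(\mu_1,\ldots,\mu_s)$ with $\mu_1>\cdots>\mu_s>0$ be strict partitions with $\mu\le\lambda$ and $r+s$ even. Let $\boldsymbol s\in ST^{\mathrm{diag}}(\lambda/\mu,\mathbb C)$, i.e. $s_{ij}=a_{j-i}$ for complex numbers $a_0,a_1,\ldots,a_{\lambda_1-1}$; also write $s_{ij}=a_{j-i}$ for every box $(i,j)\in SD(\lambda)$. Assume that the series $\zeta^Q_{\lambda/\mu}(\boldsymbol s)$ and all the series defining the $a_{ij}$ ($i<j$) and $b_{ij}$ below converge absolutely. Then \[ \zeta_{\lambda/\mu}^Q(\boldsymbol s)=\mathrm{pf}\begin{pmatrix} M_\lambda & H_{\lambda,\mu}\\ 0&0\end{pmatrix}, \] where $M_\lambda=(a_{ij})$ is the $r\times r$ strictly upper triangular matrix with $a_{ij}=\zeta^Q_{(\lambda_i,\lambda_j)}(\boldsymbol s_{(\lambda_i,\lambda_j)})$ for $i<j$, $\boldsymbol s_{(\lambda_i,\lambda_j)}$ being the shifted tableau of shape $(\lambda_i,\lambda_j)$ with first row $(s_{ii},\ldots,s_{i,t_i})$ and second row $(s_{jj},\ldots,s_{j,t_j})$, $t_i=i+\lambda_i-1$, and $H_{\lambda,\mu}=(b_{ij})$ is the $r\times s$ matrix with \[ b_{ij}=\zeta^Q_{(\lambda_i-\mu_{s-j+1})}\bigl(s_{i,\,i+\mu_{s-j+1}},\ldots,s_{i,t_i}\bigr),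 \] with the conventions that $b_{ij}=1$ if $\lambda_i=\mu_{s-j+1}$ and $b_{ij}=0$ if $\lambda_i<\mu_{s-j+1}$.
   Context: A partition $\lambda=(\lambda_1,\ldots,\lambda_r)$ is strict if $\lambda_1>\cdots>\lambda_r\ge 0$. Its shifted diagram is $SD(\lambda)=\{(i,j)\in\mathbb Z^2 : 1\le i\le r,\ i\le j\le \lambda_i+i-1\}$ (row index $i$ increasing downwards, column index $j$ increasing to the right). Write $\mu\le\lambda$ if $SD(\mu)\subset SD(\lambda)$; then $SD(\lambda/\mu)=SD(\lambda)\setminus SD(\mu)$. $ST(\lambda/\mu,X)$ is the set of fillings of $SD(\lambda/\mu)$ with elements of $X$, and $ST^{\mathrm{diag}}(\lambda/\mu,X)$ is the subset of fillings that are constant on diagonals $j-i=\mathrm{const}$. Let $\mathbb N'=\{1',1,2',2,\ldots\}$ with total order $1'<1<2'<2<\cdots$, and put $|i|=|i'|=i$. $QSST(\lambda/\mu)$ is the set of $(m_{ij})\in ST(\lambda/\mu,\mathbb N')$ such that the entries are weakly increasing along each row and each column, for each $i=1,2,\ldots$ there is at most one $i'$ in each row, and for each $i$ there is at most one $i$ in each column. The skew Schur $Q$-multiple zeta function is $\zeta^Q_{\lambda/\mu}(\boldsymbol s)=\sum_{M\in QSST(\lambda/\mu)}\prod_{(i,j)\in SD(\lambda/\mu)}|m_{ij}|^{-s_{ij}}$; $\zeta^Q_\lambda$ is the case $\mu=\emptyset$, and $\zeta^Q_{(k)}(x_1,\ldots,x_k)$ is the value on the one-row tableau with entries $x_1,\ldots,x_k$.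 For a $2n\times 2n$ upper triangular matrix $A=(a_{ij})$, $\mathrm{pf}(A)=\sum_{\pi\in\mathfrak F_{2n}}\mathrm{sgn}(\pi)\prod_{i=1}^n a_{\pi(2i-1),\pi(2i)}$, where $\mathfrak F_{2n}$ is the set of $\pi\in\mathfrak S_{2n}$ with $\pi(1)<\pi(3)<\cdots<\pi(2n-1)$ and $\pi(2i-1)<\pi(2i)$ for all $i$. *)

(* Defs.v *)
From HB Require Import structures.
From mathcomp Require Import all_boot all_order all_algebra all_fingroup finmap.
From mathcomp Require Import complex.
From mathcomp Require Import all_classical all_reals all_analysis.
From mathcomp Require summability.

Set Implicit Arguments.
Unset Strict Implicit.
Unset Printing Implicit Defensive.
Import Order.TTheory GRing.Theory Num.Theory.
Import numFieldNormedType.Exports.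
Local Open Scope ring_scope.

Definition strict_partition (lam : seq nat) : bool := sorted gtn lam.

(* Boxes are numbered from 1, as pairs (row, column). *)
Definition SD (lam : seq nat) : {fset nat * nat} :=
  [fset b in [seq (i, j) | i <- index_iota 1 (size lam).+1,
                           j <- index_iota i (nth 0%N lam i.-1 + i)]]%fset.

Lemma mem_SD (lam : seq nat) (i j : nat) :
  ((i, j) \in SD lam) =
  [&& 1 <= i <= size lam & i <= j <= nth 0 lam i.-1 + i - 1]%N.
Proof.
rewrite /SD inE /=; apply/allpairsPdep/idP => [[x [y []]]|].
  rewrite !mem_index_iota => /andP[x1 xs] /andP[xy yl] [-> ->].
  by rewrite x1 xy -ltnS xs /= subn1 -ltnS prednK // (leq_ltn_trans _ yl).
case/andP => /andP[i1 ir] /andP[ij jl]; exists i, j; split=> //.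
  by rewrite mem_index_iota i1 ltnS.
rewrite mem_index_iota ij /=; move: jl; rewrite subn1 -ltnS prednK //.
by rewrite addn_gt0 i1 orbT.
Qed.

Definition SDskew (lam mu : seq nat) : {fset nat * nat} :=
  (SD lam `\` SD mu)%fset.

Definition ST (lam mu : seq nat) (X : Type) : Type := {ffun SDskew lam mu -> X}.

(* The tableau entry s i j equals a (j - i): on a shifted diagram i <= j. *)
Definition diag_with (lam mu : seq nat) (X : Type) (a : nat -> X)
    (s : ST lam mu X) : Prop :=
  forall b : SDskew lam mu, s b = a ((val b).2 - (val b).1)%N.

(* (k, false) stands for (k+1)' and (k, true) for k+1, so that the
   lexicographic order is 1' < 1 < 2' < 2 < ... *)
Notation marked := (nat *l bool)%type.

Definition mark_abs (m : marked) : nat := m.1.+1.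
Definition is_primed (m : marked) : bool := ~~ m.2.

Definition is_QSST (lam mu : seq nat)
    (M : {ffun SDskew lam mu -> marked}) : bool :=
  [&& [forall b : SDskew lam mu, forall c : SDskew lam mu,
         ((val b).1 == (val c).1) && ((val b).2 <= (val c).2)%N
         ==> (M b <= M c)%O],
      [forall b : SDskew lam mu, forall c : SDskew lam mu,
         ((val b).2 == (val c).2) && ((val b).1 <= (val c).1)%N
         ==> (M b <= M c)%O],
      [forall b : SDskew lam mu, forall c : SDskew lam mu,
         [&& (val b).1 == (val c).1, M b == M c & is_primed (M b)]
         ==> (b == c)]
    & [forall b : SDskew lam mu, forall c : SDskew lam mu,
         [&& (val b).2 == (val c).2, M b == M c & ~~ is_primed (M b)]
         ==> (b == c)]].

Notation QSST lam mu :=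
  {M : {ffun SDskew lam mu -> marked} | @is_QSST lam mu M}.

Section Zeta.
Context {R : realType}.

Definition cexp (z : R[i]) : R[i] :=
  Complex (expR (complex.Re z) * cos (complex.Im z))
          (expR (complex.Re z) * sin (complex.Im z)).

Definition npow (n : nat) (z : R[i]) : R[i] := cexp (z * (ln (n%:R : R))%:C%C).

Definition zetaQ_term (lam mu : seq nat) (s : ST lam mu R[i])
    (M : QSST lam mu) : R[i] :=
  \prod_(b : SDskew lam mu) npow (mark_abs (val M b)) (- s b).

Definition zetaQ_abscvg (lam mu : seq nat) (s : ST lam mu R[i]) : Prop :=
  summable [set: QSST lam mu] (fun M => (Normc.normc (zetaQ_term s M))%:E).

(* The limit, along finite sets of tableaux ordered by inclusion, of the finite
   partial sums; R[i]^o carries the topology given by the complex modulus. *)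
Definition zetaQ (lam mu : seq nat) (s : ST lam mu R[i]) : R[i] :=
  summability.sum (zetaQ_term s : QSST lam mu -> R[i]^o).

Definition rows_tableau (rows : seq (seq R[i])) :
    ST (map size rows) [::] R[i] :=
  [ffun b => nth 0 (nth [::] rows (val b).1.-1) ((val b).2 - (val b).1)].

End Zeta.

Section Pfaffian.
Variables (K : comNzRingType) (n : nat).

(* Positions 2i-1 and 2i of 1..2n, for i = 1..n, are here i.*2 and i.*2.+1. *)
Definition pos_fst (i : 'I_n) : 'I_n.*2 :=
  Ordinal (etrans (ltn_double i n) (ltn_ord i)).
Definition pos_snd (i : 'I_n) : 'I_n.*2 :=
  Ordinal (etrans (ltn_Sdouble i n) (ltn_ord i)).

Definition pfaffian_perms : {set 'S_(n.*2)} :=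
  [set p : 'S_(n.*2) |
     [forall i : 'I_n, forall j : 'I_n,
        (i < j)%N ==> (p (pos_fst i) < p (pos_fst j))%N] &&
     [forall i : 'I_n, (p (pos_fst i) < p (pos_snd i))%N]].

Definition pf (A : 'M[K]_(n.*2)) : K :=
  \sum_(p in pfaffian_perms)
     (-1) ^+ p * \prod_(i < n) A (p (pos_fst i)) (p (pos_snd i)).

End Pfaffian.

Section Matrices.
Context {R : realType}.
Variables (r l : nat) (lam : r.-tuple nat) (mu : l.-tuple nat).
Variable a : nat -> R[i].

(* The values s_{i,j}, ..., s_{i,t_i}, where s_{ij} = a_{j-i} on all of
   SD lam and t_i = i + lam_i - 1; here i is 0-based, so the row is i.+1. *)
Definition row_from (i : 'I_r) (j : nat) : seq R[i] :=
  [seq a (k - i.+1)%N | k <- index_iota j (i.+1 + tnth lam i)].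

Definition pair_tableau (i j : 'I_r) :=
  rows_tableau [:: row_from i i.+1; row_from j j.+1].

Lemma shape_pair_tableau (i j : 'I_r) :
  map size [:: row_from i i.+1; row_from j j.+1] = [:: tnth lam i; tnth lam j].
Proof. by rewrite /= !size_map !size_iota !addKn. Qed.

Definition mu_rev (j : 'I_l) : nat := tnth mu (rev_ord j).

Definition tail_tableau (i : 'I_r) (j : 'I_l) :=
  rows_tableau [:: row_from i (i.+1 + mu_rev j)].

Lemma shape_tail_tableau (i : 'I_r) (j : 'I_l) :
  map size [:: row_from i (i.+1 + mu_rev j)] = [:: (tnth lam i - mu_rev j)%N].
Proof. by rewrite /= !size_map !size_iota subnDl. Qed.

Definition M_mx : 'M[R[i]]_r :=
  \matrix_(i, j) if (i < j)%N then zetaQ (pair_tableau i j) else 0.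

Definition H_mx : 'M[R[i]]_(r, l) :=
  \matrix_(i, j)
    if (tnth lam i < mu_rev j)%N then 0
    else if tnth lam i == mu_rev j then 1
    else zetaQ (tail_tableau i j).

End Matrices.

(* Main.v *)
Require Import Defs.
From mathcomp Require Import all_boot all_order all_algebra all_fingroup finmap complex.
From mathcomp Require Import all_classical all_reals all_analysis.
From mathcomp Require summability.
From mathcomp Require Import zify ring.

(** A marked shifted tableau is a history of its shape. Order the pairs
(letter, diagonal) by letter, and for one letter by decreasing diagonal if it
is primed and by increasing diagonal if it is not: call the place of a pair in
this list its time. The conditions on marked tableaux then say exactly that
times increase strictly along rows and down columns ([is_QSST_time]). So the
tableaux with entries at most N are the ways to peel the shape lambda down to mu
one box at a time, by going through the finite list of times backwards and at
each time removing or not removing the corner on its diagonal, if there is one.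
The truncated zeta function hence satisfies a recursion on the number of times
([growth], [sum_time_filling]): a new time t of diagonal d adds x_t times the
value at the shape in which the row of length d + 1 becomes d, provided that
there is such a row and no row of length d > 0.

Truncated Pfaffians satisfy the same recursion ([growth_pfword]). Index the
matrix by letters: the rows of lambda by their lengths, then the parts of mu
from the smallest to the largest. The entries are themselves truncated zeta
functions of one or two rows, so at the time t the letter d + 1 is replaced by
the letter d + 1 plus x_t times the letter d: a row and column operation. The
Pfaffian is linear in each letter ([pfword_row_add]), which gives the two terms
of the recursion; when lambda has also a row of length d > 0, the second Pfaffian
has two equal neighbouring letters and vanishes ([pfword_double]). A row which
becomes empty stays in the word as the letter 0, paired with itself by 1, so that
two empty rows can be erased; this makes the parity of the number of rows
harmless. Before any time has passed, both sides are 1 if lambda = mu and 0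
otherwise ([pfword_entry0]).

What remains is analysis. Each of the series converges absolutely, so it is the
limit of its truncations ([cvg_zetaQ]); the Pfaffian is a polynomial in the
entries, and the identity passes to the limit ([cvg_pfword]).

The Pfaffian of a matrix enters through its expansion along the first row
([pf_recl]), which makes it the Pfaffian of the word of all its indices
([pf_pfword]). *)

Set Implicit Arguments.
Unset Strict Implicit.
Unset Printing Implicit Defensive.
Import Order.TTheory GRing.Theory Num.Theory.
Import numFieldNormedType.Exports.
Local Open Scope ring_scope.

(** * The Pfaffian of a word *)

Section PfaffianOfWords.
Variable K : comNzRingType.

(** The alternating sum over the places i of w of (-1)^i b(w_i) g(w without w_i).
The recursion on w keeps a letter by composing g with its insertion, so that no
place needs to be named. *)
Fixpoint wcontract (T : Type) (b : T -> K) (g : seq T -> K) (w : seq T) : K :=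
  if w is y :: v then b y * g v - wcontract b (fun u => g (y :: u)) v else 0.

(** Expansion along the first letter. The number n of pairs makes the recursion
structural; a word whose length is not 2n gets the value 0. Only the values
a x y with x before y in the word enter, as for an upper triangular matrix. *)
Fixpoint pfword (T : Type) (a : T -> T -> K) (n : nat) (w : seq T) : K :=
  match n, w with
  | 0, [::] => 1
  | n'.+1, x :: v => wcontract (a x) (pfword a n') v
  | _, _ => 0
  end.

Section Contraction.
Variable T : eqType.
Implicit Types (b : T -> K) (g : seq T -> K) (w : seq T).

Lemma wcontract_map (S : eqType) (phi : T -> S) b g (b' : S -> K)
    (g' : seq S -> K) w :
    {in w, b =1 b' \o phi} ->
    (forall v, subseq v w -> g v = g' (map phi v)) ->
  wcontract b g w = wcontract b' g' (map phi w).
Proof.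
elim: w g g' => // y w IHw g g' eqb eqg /=.
rewrite eqb ?mem_head // eqg ?subseq_cons //=; congr (_ - _).
apply: IHw => [z zw | v vw]; first by rewrite eqb // inE zw orbT.
by rewrite eqg /= ?eqxx.
Qed.

Lemma eq_wcontract b g b' g' w :
    {in w, b =1 b'} -> (forall v, subseq v w -> g v = g' v) ->
  wcontract b g w = wcontract b' g' w.
Proof.
move=> eqb eqg; rewrite (@wcontract_map _ id b g b' g') ?map_id // => v vw.
by rewrite map_id eqg.
Qed.

Lemma wcontract_eq0 b g w :
  (forall v, subseq v w -> g v = 0) -> wcontract b g w = 0.
Proof.
elim: w g => // y w IHw g g0 /=.
rewrite g0 ?subseq_cons // mulr0 IHw ?subr0 // => v vw.
by rewrite g0 /= ?eqxx.
Qed.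

Lemma wcontract_eq0l b g w : {in w, forall z, b z = 0} -> wcontract b g w = 0.
Proof.
elim: w g => // y w IHw g b0 /=.
rewrite b0 ?mem_head // mul0r IHw ?subr0 // => z zw.
by rewrite b0 // inE zw orbT.
Qed.

Lemma wcontractDl b b' x g w :
  wcontract (fun z => b z + x * b' z) g w = wcontract b g w + x * wcontract b' g w.
Proof.
elim: w g => [|y w IHw] g /=; first by rewrite mulr0 addr0.
by rewrite IHw mulrDl mulrBr opprD addrACA mulrA.
Qed.

Lemma wcontractDr b g g' x w :
  wcontract b (fun v => g v + x * g' v) w = wcontract b g w + x * wcontract b g' w.
Proof.
elim: w g g' => [|y w IHw] g g' /=; first by rewrite mulr0 addr0.
by rewrite IHw mulrDr mulrBr opprD addrACA mulrCA.
Qed.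

Lemma wcontractZr b g c w :
  wcontract b (fun v => c * g v) w = c * wcontract b g w.
Proof.
elim: w g => [|y w IHw] g /=; first by rewrite mulr0.
by rewrite IHw mulrBr mulrCA.
Qed.

(** Two letters can be deleted in either order, and the two orders come with
opposite signs. *)
Lemma wcontract_wcontract b g w : wcontract b (wcontract b g) w = 0.
Proof.
elim: w g => // y w IHw g /=.
pose h := wcontract b (fun u => g (y :: u)).
rewrite (@eq_wcontract b (fun u => wcontract b g (y :: u)) b
  (fun v => (-1) * h v + b y * g v)) => [|//|v _]; last first.
  by rewrite /= mulN1r addrC.
by rewrite wcontractDr wcontractZr IHw mulr0 add0r subrr.
Qed.

(** Deleting the first or the second of two equal neighbours leaves the same
word, with opposite signs; what survives keeps both. *)
Lemma wcontract_double b g g0 c y u v :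
    (forall u' v', g (u' ++ [:: y, y & v']) = c * g0 (u' ++ v')) ->
  wcontract b g (u ++ [:: y, y & v]) = c * wcontract b g0 (u ++ v).
Proof.
elim: u g g0 => [|z u IHu] g g0 eqg /=.
  rewrite opprD addNKr opprK -wcontractZr.
  by apply: eq_wcontract => // w _; rewrite -[LHS]/(g ([::] ++ _)) eqg.
rewrite eqg (IHu _ (fun w => g0 (z :: w))); first by rewrite mulrBr mulrCA.
by move=> u' v'; rewrite -!cat_cons eqg.
Qed.

Lemma wcontract_row_add b g b' g' x y y0 u v :
    {in u ++ v, b' =1 b} -> b' y = b y + x * b y0 ->
    (forall w, subseq w (u ++ v) -> g' w = g w) ->
    (forall u' v', subseq u' u -> subseq v' v ->
       g' (u' ++ y :: v') = g (u' ++ y :: v') + x * g (u' ++ y0 :: v')) ->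
  wcontract b' g' (u ++ y :: v) =
    wcontract b g (u ++ y :: v) + x * wcontract b g (u ++ y0 :: v).
Proof.
elim: u g g' => [|z u IHu] g g' eqb eqby eqg eqgy /=.
  rewrite eqby eqg //.
  rewrite (@eq_wcontract b' _ b (fun w => g (y :: w) + x * g (y0 :: w))).
  - by rewrite wcontractDr mulrDl mulrBr opprD addrACA mulrA.
  - exact: eqb.
  - by move=> w wv; rewrite -[LHS]/(g' ([::] ++ _)) eqgy //= sub0seq.
rewrite eqb ?mem_head // eqgy ?subseq_cons //.
rewrite (IHu (fun w => g (z :: w))).
- by rewrite mulrDr mulrBr opprD addrACA mulrCA.
- by move=> t tuv; rewrite eqb // inE tuv orbT.
- by [].
- by move=> w wuv; rewrite eqg //= eqxx.
- by move=> u' v' u'u v'v; rewrite -!cat_cons eqgy /= ?eqxx.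
Qed.

(** Either y itself is deleted, at the price b y = 0, or it stays. *)
Lemma wcontract_dead b g y w :
    y \in w -> b y = 0 ->
    (forall v, subseq v w -> y \in v -> g v = 0) ->
  wcontract b g w = 0.
Proof.
elim: w g => // z w IHw g yzw by0 g0 /=.
have [yw | ynw] := boolP (y \in w).
  rewrite g0 ?subseq_cons // mulr0 IHw ?subr0 // => v vw yv.
  by rewrite g0 /= ?eqxx // inE yv orbT.
move: yzw; rewrite inE (negPf ynw) orbF => /eqP yz; subst z.
rewrite by0 mul0r wcontract_eq0 ?subr0 // => v vw.
by rewrite g0 ?mem_head /= ?eqxx.
Qed.

Lemma wcontract_rcons b g v y :
  {in v, forall z, b z = 0} ->
  wcontract b g (rcons v y) = (-1) ^+ size v * b y * g v.
Proof.
elim: v g => [|z v IHv] g b0 /=; first by rewrite subr0 expr0 mul1r.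
rewrite b0 ?mem_head // mul0r add0r IHv => [|t tv]; last first.
  by rewrite b0 // inE tv orbT.
by rewrite exprS mulN1r !mulNr.
Qed.

End Contraction.

Section Pfword.
Variable T : eqType.
Implicit Types (a : T -> T -> K) (w : seq T).

Lemma pfword_map (S : eqType) (phi : T -> S) (r : rel T) a (a' : S -> S -> K)
    n w :
    pairwise r w -> (forall x y, r x y -> a x y = a' (phi x) (phi y)) ->
  pfword a n w = pfword a' n (map phi w).
Proof.
move=> rw eqa; elim: n w rw => [|n IHn] [|x w] //= /andP[/allP rxw rw].
apply: wcontract_map => [y yw | v vw]; first exact/eqa/rxw.
exact/IHn/(subseq_pairwise vw rw).
Qed.

Lemma eq_pfword a a' n w :
  {in w &, forall x y, a x y = a' x y} -> pfword a n w = pfword a' n w.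
Proof.
elim: n w => [|n IHn] [|x w] //= eqa.
apply: eq_wcontract => [y yw | v vw]; first by rewrite eqa ?mem_head // inE yw orbT.
by apply: IHn => y z /(mem_subseq vw) yw /(mem_subseq vw) zw;
  rewrite eqa // inE ?yw ?zw orbT.
Qed.

(** For a y y = 0 this says that the Pfaffian is alternating; for a y y = 1 it
erases a pair of equal letters. In both cases the two letters y pair alike with
all the others, so only the pairing of y with y is left. *)
Lemma pfword_double a y n u v :
  pfword a n.+1 (u ++ [:: y, y & v]) = a y y * pfword a n (u ++ v).
Proof.
elim: n u v => [|n IHn] [|z u] v.
- rewrite /= wcontract_eq0 ?subr0 //.
- rewrite [LHS]/= (@wcontract_double _ _ _ (fun _ => 0) (a y y)) /= => [|u' v'].
    by rewrite wcontract_eq0 ?mulr0.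
  by rewrite mulr0; case: u'.
- rewrite -[LHS]/(a y y * pfword a n.+1 v -
    wcontract (a y) (wcontract (a y) (pfword a n)) v).
  by rewrite wcontract_wcontract subr0.
- by apply: wcontract_double => u' v'; exact: (IHn u' v').
Qed.

Lemma pfword_nseq a y n : pfword a n (nseq n.*2 y) = a y y ^+ n.
Proof.
elim: n => [|n IHn]; first by rewrite expr0.
by rewrite doubleS exprS -IHn; apply: (@pfword_double a y n [::]).
Qed.

(** Multilinearity: replacing the letter y by y + x y0 in all pairings. The
letters before y and those after y are treated apart because only pairs in the
order of the word are compared. *)
Lemma pfword_row_add a a' x y y0 n u v :
    {in u, forall z, a' z y = a z y + x * a z y0} ->
    {in v, forall z, a' y z = a y z + x * a y0 z} ->
    {in u ++ v &, forall z z', a' z z' = a z z'} ->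
  pfword a' n (u ++ y :: v) =
    pfword a n (u ++ y :: v) + x * pfword a n (u ++ y0 :: v).
Proof.
elim: n u v => [|n IHn] [|z u] v eqcol eqrow eqa /=;
  rewrite ?mulr0 ?addr0 //.
  rewrite -wcontractDl; apply: eq_wcontract => // w wv.
  by apply: eq_pfword => t t' /(mem_subseq wv) tv /(mem_subseq wv) t'v; apply: eqa.
apply: wcontract_row_add => [t tuv||w wuv|u' v' u'u v'v].
- by rewrite eqa ?mem_head // inE tuv orbT.
- by rewrite eqcol ?mem_head.
- apply: eq_pfword => t t' /(mem_subseq wuv) tv /(mem_subseq wuv) t'v.
  by rewrite eqa // inE ?tv ?t'v orbT.
apply: IHn => [t /(mem_subseq u'u) tu | t /(mem_subseq v'v) tv | t t' tin t'in].
- by rewrite eqcol // inE tu orbT.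
- exact: eqrow.
- have sub : {subset u' ++ v' <= u ++ v} := mem_subseq (cat_subseq u'u v'v).
  by rewrite eqa // inE sub ?orbT.
Qed.

Lemma pfword_dead a y n w :
    y \in w -> {in w, forall z, a z y = 0 /\ a y z = 0} -> pfword a n w = 0.
Proof.
elim: n w => [|n IHn] [|x w] //= yxw a0.
have [yw | ynw] := boolP (y \in w).
  apply: (wcontract_dead yw) => [|v vw yv]; first by have [] := a0 x (mem_head _ _).
  by apply: IHn => // z /(mem_subseq vw) zw; apply: a0; rewrite inE zw orbT.
move: yxw; rewrite inE (negPf ynw) orbF => /eqP yx.
apply: wcontract_eq0l => z zw.
by rewrite -yx; have [] := a0 z; rewrite ?inE ?zw ?orbT.
Qed.

End Pfword.
End PfaffianOfWords.

(** * The Pfaffian of a matrix as the Pfaffian of a word *)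

Section PfaffianRecursion.
Variable K : comNzRingType.

Lemma map_enum_ordSl (T : Type) m (psi : 'I_m.+1 -> T) :
  [seq psi i | i <- enum 'I_m.+1] =
    psi ord0 :: [seq psi (lift ord0 i) | i <- enum 'I_m].
Proof. by rewrite enum_ordSl map_cons -map_comp. Qed.

Lemma wcontract_enum (T : eqType) m (psi : 'I_m.+1 -> T) (b : T -> K) g :
  wcontract b g [seq psi i | i <- enum 'I_m.+1] =
    \sum_(j < m.+1) (-1) ^+ j * b (psi j) *
       g [seq psi (lift j k) | k <- enum 'I_m].
Proof.
elim: m psi g => [|m IHm] psi g.
  by rewrite map_enum_ordSl big_ord_recl big_ord0 (size0nil (size_enum_ord 0))
             /= expr0 mul1r subr0 addr0.
rewrite map_enum_ordSl big_ord_recl expr0 mul1r /= IHm -sumrN.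
congr (_ + _); apply: eq_bigr => j _.
rewrite map_enum_ordSl /bump leq0n add1n exprS -!mulrA !mulN1r; congr (- (_ * (_ * g (_ :: _)))).
  by congr psi; apply: val_inj.
by apply: eq_map => k; congr psi; apply: val_inj => /=; rewrite /bump /= ltnS; case: leqP.
Qed.

Lemma lift_perm_onto m (q : 'S_m.+1) : exists s, q = lift_perm ord0 (q ord0) s.
Proof.
have liftP k : exists k', q (lift ord0 k) = lift (q ord0) k'.
  have /unlift_some[k' -> _] : q ord0 != q (lift ord0 k).
    by rewrite (inj_eq perm_inj) neq_lift.
  by exists k'.
have /fin_all_exists[f fP] := liftP.
have f_inj : injective f.
  move=> k k' /(congr1 (lift (q ord0))); rewrite -!fP => /perm_inj.
  exact: lift_inj.
exists (perm f_inj); apply/permP => k.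
by case: (unliftP ord0 k) => [k'|] ->; rewrite ?lift_perm_id ?lift_perm_lift ?permE.
Qed.

Lemma ltn_lift m (h : 'I_m.+1) (i j : 'I_m) : (lift h i < lift h j)%N = (i < j)%N.
Proof. by rewrite !ltnNge leq_bump2. Qed.

Variable n : nat.
Implicit Types (A : 'M[K]_(n.*2.+2)) (j : 'I_(n.*2).+1) (s : 'S_(n.*2)).

(** A permutation of the kind summed over in the Pfaffian has 0 as its first
value. It is determined by its second value, lift ord0 j, and by the pattern s of
its other values. *)
Definition first_pair_perm (js : 'I_(n.*2).+1 * 'S_(n.*2)) : 'S_(n.*2.+2) :=
  lift_perm ord0 ord0 (lift_perm ord0 js.1 js.2).

Lemma pos_fst0 : @pos_fst n.+1 ord0 = ord0 :> 'I_(n.*2).+2.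
Proof. exact: val_inj. Qed.

Lemma pos_snd0 : @pos_snd n.+1 ord0 = lift ord0 ord0 :> 'I_(n.*2).+2.
Proof. exact: val_inj. Qed.

Lemma pos_fstS (i : 'I_n) :
  pos_fst (lift ord0 i) = lift ord0 (lift ord0 (pos_fst i)) :> 'I_(n.*2).+2.
Proof. exact: val_inj. Qed.

Lemma pos_sndS (i : 'I_n) :
  pos_snd (lift ord0 i) = lift ord0 (lift ord0 (pos_snd i)) :> 'I_(n.*2).+2.
Proof. exact: val_inj. Qed.

Lemma first_pair_perm0 js : first_pair_perm js ord0 = ord0.
Proof. by rewrite /first_pair_perm lift_perm_id. Qed.

Lemma first_pair_perm1 js : first_pair_perm js (lift ord0 ord0) = lift ord0 js.1.
Proof. by rewrite /first_pair_perm lift_perm_lift lift_perm_id. Qed.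

Lemma first_pair_permS js k :
  first_pair_perm js (lift ord0 (lift ord0 k)) = lift ord0 (lift js.1 (js.2 k)).
Proof. by rewrite /first_pair_perm !lift_perm_lift. Qed.

Lemma first_pair_perm_inj : injective first_pair_perm.
Proof.
move=> [j s] [j' s'] eq_h.
have ejj' : j = j'.
  by apply: (@lift_inj _ ord0); rewrite -(first_pair_perm1 (j, s)) eq_h first_pair_perm1.
subst j'; congr (_, _); apply/permP => k.
apply: (@lift_inj _ j); apply: (@lift_inj _ ord0).
by rewrite -(first_pair_permS (j, s)) eq_h first_pair_permS.
Qed.

Lemma first_pair_perm_onto (p : 'S_(n.*2.+2)) :
  p ord0 = ord0 -> exists js, p = first_pair_perm js.
Proof.
move=> p0; have [q qP] := lift_perm_onto p.
have [s sP] := lift_perm_onto q.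
by exists (q ord0, s); rewrite /first_pair_perm /= -sP {1}qP p0.
Qed.

Lemma mem_pfaffian_perms_first_pair js :
  (first_pair_perm js \in @pfaffian_perms n.+1) = (js.2 \in pfaffian_perms n).
Proof.
rewrite !inE; congr (_ && _).
  apply/'forall_'forall_implyP/'forall_'forall_implyP => H i k ik.
    have := H (lift ord0 i) (lift ord0 k).
    by rewrite !pos_fstS !first_pair_permS !ltn_lift; apply.
  case: (unliftP ord0 k) ik => [k'|] -> // ik.
  case: (unliftP ord0 i) ik => [i'|] -> ik.
    by move: ik; rewrite !pos_fstS !first_pair_permS !ltn_lift; apply: H.
  by rewrite pos_fst0 pos_fstS first_pair_perm0 first_pair_permS.
apply/forallP/forallP => H i.
  by have := H (lift ord0 i); rewrite pos_fstS pos_sndS !first_pair_permS !ltn_lift.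
case: (unliftP ord0 i) => [i'|] ->.
  by rewrite pos_fstS pos_sndS !first_pair_permS !ltn_lift.
by rewrite pos_fst0 pos_snd0 first_pair_perm0 first_pair_perm1.
Qed.

(** The value 0 is taken at a first position, as it is not larger than its
partner, and at the very first of these, as they increase. *)
Lemma pfaffian_perms0 (p : 'S_(n.*2.+2)) :
  p \in @pfaffian_perms n.+1 -> p ord0 = ord0.
Proof.
rewrite inE => /andP[/'forall_'forall_implyP fst_lt /forallP snd_lt].
have [x x0] : exists x, p x = ord0 by exists ((p^-1)%g ord0); rewrite permKV.
have half_lt : (x./2 < n.+1)%N by rewrite ltn_half_double doubleS.
pose i := Ordinal half_lt.
have [oddx | evenx] := boolP (odd x).
  have := snd_lt i; suff -> : pos_snd i = x by rewrite x0.
  by apply: val_inj => /=; rewrite -[RHS]odd_double_half oddx.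
have xE : pos_fst i = x.
  by apply: val_inj => /=; rewrite -[RHS]odd_double_half (negPf evenx).
case: (unliftP ord0 i) => [i' iE | iE].
  by have := fst_lt ord0 i; rewrite {1}iE => /(_ isT); rewrite xE x0.
by move: x0; rewrite -xE iE pos_fst0.
Qed.

(** Expansion along the first row: split the sum by the partner of 0. The sign of
[first_pair_perm] is the product of (-1)^j and of the sign of the remaining
permutation. *)
Lemma pf_recl A :
  @pf K n.+1 A = \sum_(j < (n.*2).+1) (-1) ^+ j * A ord0 (lift ord0 j) *
    @pf K n (mxsub (fun k => lift ord0 (lift j k)) (fun k => lift ord0 (lift j k)) A).
Proof.
rewrite /pf.
have -> : @pfaffian_perms n.+1 = first_pair_perm @: [set js | js.2 \in pfaffian_perms n].
  apply/setP => p; apply/idP/imsetP => [pPF | [js]]; last first.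
    by rewrite inE => jsPF ->; rewrite mem_pfaffian_perms_first_pair.
  have [js pE] := first_pair_perm_onto (pfaffian_perms0 pPF).
  by exists js => //; rewrite inE -mem_pfaffian_perms_first_pair -pE.
rewrite big_imset /=; last by move=> ? ? _ _; apply: first_pair_perm_inj.
under [RHS]eq_bigr do rewrite big_distrr /=.
rewrite pair_big_dep /=; apply: eq_big => [js | js _]; first by rewrite inE.
have -> : (-1) ^+ first_pair_perm js = (-1) ^+ js.1 * (-1) ^+ js.2 :> K.
  by rewrite !odd_lift_perm /= signr_addb signr_odd.
rewrite -!mulrA big_ord_recl; congr (_ * _).
rewrite pos_fst0 pos_snd0 first_pair_perm0 first_pair_perm1 mulrCA; congr (_ * (_ * _)).
apply: eq_bigr => i _.
by rewrite mxE pos_fstS pos_sndS !first_pair_permS.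
Qed.
End PfaffianRecursion.

Section PfaffianWord.
Variable K : comNzRingType.

Lemma pf_pfword n (A : 'M[K]_(n.*2)) :
  pf A = pfword (fun i j => A i j) n (enum 'I_(n.*2)).
Proof.
elim: n A => [|n IHn] A.
  rewrite (size0nil (size_enum_ord 0)) /pf (eq_bigr (fun=> 1)) => [|p _]; last first.
    by rewrite big_ord0 mulr1 (_ : p = 1%g) ?odd_perm1 //; apply/permP => -[].
  rewrite big_const iter_addr_0 (_ : #|_| = 1%N) //.
  apply/eqP/cards1P; exists 1%g; apply/setP => p; rewrite !inE.
  rewrite (_ : p = 1%g) ?eqxx; last by apply/permP => -[].
  by apply/andP; split; apply/forallP => -[].
rewrite (@pf_recl K n A) -[enum _]map_id (@map_enum_ordSl _ n.*2.+1 id).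
rewrite [RHS]/= wcontract_enum; apply: eq_bigr => j _; congr (_ * _).
rewrite IHn (@pfword_map _ _ _ (fun k => lift ord0 (lift j k)) (fun _ _ => true) _
  (fun i j => A i j)) //.
  by elim: (enum _) => //= x w ->; rewrite andbT; apply/allP.
by move=> x y _; rewrite mxE.
Qed.

End PfaffianWord.

(** * Peeling boxes off a strict partition *)

(** Strictly decreasing parts followed by zeros. The zeros keep the number of
rows constant while boxes are removed, and an empty row is a letter of the
Pfaffian like any other row. *)
Definition padded_strict (lam : seq nat) : bool :=
  pairwise (fun p q => (q == 0) || (q < p))%N lam.

(** The diagonals are numbered from 0, so d is the diagonal of the last box of a
row of length d + 1. That box is a corner unless the next row has length d > 0. *)
Definition removable (d : nat) (lam : seq nat) : bool :=
  (d.+1 \in lam) && ((d == 0%N) || (d \notin lam)).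

Definition lower (d : nat) (lam : seq nat) : seq nat :=
  [seq if p == d.+1 then d else p | p <- lam].

Lemma size_lower d lam : size (lower d lam) = size lam.
Proof. by rewrite size_map. Qed.

Lemma padded_strict_split d lam :
    padded_strict lam -> d.+1 \in lam ->
  exists u v, [/\ lam = u ++ d.+1 :: v, all (ltn d.+1) u,
    all (fun q => (q == 0) || (q < d.+1))%N v & padded_strict (u ++ v)].
Proof.
move=> + /splitPr s; case: s => u v.
rewrite /padded_strict pairwise_cat allrel_consr /= => /and3P[/andP[ud uv] pu].
move=> /andP[dv pv]; exists u, v; split=> //.
  by rewrite pairwise_cat uv pu.
Qed.

Lemma lower_split d u v :
    all (ltn d.+1) u -> all (fun q => (q == 0) || (q < d.+1))%N v ->
  lower d (u ++ d.+1 :: v) = u ++ d :: v.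
Proof.
move=> /allP ud /allP dv; rewrite /lower map_cat /= eqxx.
congr (_ ++ _ :: _); rewrite -[RHS]map_id; apply/eq_in_map => p.
  by move=> /ud /= dp; case: eqP => // pd; lia.
by move=> /dv /= dp; case: eqP => // pd; lia.
Qed.

Lemma removable_split d u v :
    all (ltn d.+1) u -> all (fun q => (q == 0) || (q < d.+1))%N v ->
  removable d (u ++ d.+1 :: v) = (d == 0)%N || (d \notin v).
Proof.
move=> /allP ud /allP dv; rewrite /removable !mem_cat !inE eqxx orbT /=.
case: (d =P 0%N) => //= d0; rewrite !negb_or.
have -> : d \notin u by apply/negP => /ud /=; lia.
by rewrite -(inj_eq succn_inj) eqn_leq ltnn andbF.
Qed.

Lemma padded_strict_lower d lam :
  padded_strict lam -> removable d lam -> padded_strict (lower d lam).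
Proof.
move=> lamP rem; have /andP[dlam _] := rem.
have [u [v [lamE ud dv puv]]] := padded_strict_split lamP dlam.
move: rem puv; rewrite lamE removable_split // lower_split // /padded_strict.
rewrite !pairwise_cat allrel_consr /= => dnv /and3P[-> -> ->]; rewrite !andbT.
apply/andP; split; first by apply: sub_all ud => p /=; lia.
apply/allP => q qv; have /allP/(_ _ qv) := dv.
have : q != d \/ d = 0%N.
  by case/orP: dnv => [/eqP ->|dnv]; [right | left; apply: contraNneq dnv => <-].
by lia.
Qed.

Section Growth.
Variables (K : comNzRingType) (c : nat -> nat) (x : nat -> K).

(** The times are 0, ..., t - 1, time t' being able to remove a box on the
diagonal c t' with weight x t'; [growth mu t lam] sums the weights of all ways to
go from lam to mu, from the last time to the first. *)
Fixpoint growth (mu : seq nat) (t : nat) (lam : seq nat) : K :=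
  if t is t'.+1 then
    growth mu t' lam +
    (if removable (c t') lam then x t' * growth mu t' (lower (c t') lam) else 0)
  else (lam == mu)%:R.

(** The letter inl p is a row of length p, the letter inr m a row of mu. The
values at p <= q are only a convention, with two essential cases: 0 at p = q > 0,
which makes words with two equal rows vanish, and 1 at p = q = 0, which lets two
empty rows disappear. *)
Definition entry (t : nat) (y z : nat + nat) : K :=
  match y, z with
  | inl p, inl q => if (q == 0%N) || (q < p)%N then growth [:: 0%N; 0%N] t [:: p; q] else 0
  | inl p, inr m => growth [:: m] t [:: p]
  | _, _ => 0
  end.

Definition word (lam mu : seq nat) : seq (nat + nat) :=
  map inl lam ++ map inr (rev mu).

Lemma growth_lt m t p : (p < m)%N -> growth [:: m] t [:: p] = 0.
Proof.
elim: t p => [|t IHt] p pm /=; first by rewrite eqseq_cons ltn_eqF.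
rewrite IHt // add0r; case: ifP => // /andP[]; rewrite /= inE => /eqP cp _.
by rewrite cp eqxx IHt ?mulr0 //; lia.
Qed.

Lemma growth_refl m t : growth [:: m] t [:: m] = 1.
Proof.
elim: t => [|t IHt] /=; first by rewrite eqxx.
rewrite IHt; case: ifP; rewrite ?addr0 // => /andP[]; rewrite inE => /eqP cm _.
by rewrite cm eqxx growth_lt ?mulr0 ?addr0 //; lia.
Qed.

(** A new time acts on the entries as a row and column operation on the single
letter c t + 1: here away from that letter, and then ([entry_col], [entry_row],
[entry_row_mu]) on its column and its row. *)
Lemma entry_other t y z :
  y != inl (c t).+1 -> z != inl (c t).+1 -> entry t.+1 y z = entry t y z.
Proof.
case: y z => [p|?] [q|m] //= py qy.
- case: ifP => // _; rewrite /removable !inE.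
  have -> : ((c t).+1 == p) = false by apply/negbTE; apply: contra py => /eqP->.
  have -> : ((c t).+1 == q) = false by apply/negbTE; apply: contra qy => /eqP->.
  by rewrite addr0.
- rewrite /removable !inE.
  have -> : ((c t).+1 == p) = false by apply/negbTE; apply: contra py => /eqP->.
  by rewrite addr0.
Qed.

Lemma entry_col t p : ((c t).+1 < p)%N ->
  entry t.+1 (inl p) (inl (c t).+1) =
    entry t (inl p) (inl (c t).+1) + x t * entry t (inl p) (inl (c t)).
Proof.
move=> cp; have e1 : (c t == p) = false by apply/eqP; lia.
have e2 : (c t == (c t).+1) = false by apply/eqP; lia.
have e3 : (p == (c t).+1) = false by apply/eqP; lia.
by rewrite /= cp (ltnW cp) orbT /removable !inE eqxx e1 e2 e3 !orbT.
Qed.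

Lemma entry_row t q : (q == 0)%N || (q < (c t).+1)%N ->
  entry t.+1 (inl (c t).+1) (inl q) =
    entry t (inl (c t).+1) (inl q) + x t * entry t (inl (c t)) (inl q).
Proof.
move=> qc; have e1 : (c t == (c t).+1) = false by apply/eqP; lia.
have e2 : (q == (c t).+1) = false by apply/eqP; lia.
rewrite /= qc /removable !inE eqxx e1 e2 /=; congr (_ + _).
have -> : (c t == 0%N) || (c t != q) = ((q == 0%N) || (q < c t)%N).
  by apply/idP/idP; lia.
by case: ifP; rewrite ?mulr0.
Qed.

Lemma entry_row_mu t m :
  entry t.+1 (inl (c t).+1) (inr m) =
    entry t (inl (c t).+1) (inr m) + x t * entry t (inl (c t)) (inr m).
Proof.
rewrite /= /removable !inE eqxx /=.
have -> : (c t == (c t).+1) = false by apply/eqP; lia.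
by rewrite orbT.
Qed.

(** With no time available a row can only be paired with an equal row of mu, or an
empty row with an empty one. As the largest row of lam and the largest row of mu
stand at the two ends of the word, comparing them either gives a letter that pairs
with nothing, or a pair whose sign is + and whose removal leaves the same
situation. *)
Lemma pfword_entry0 n lam mu :
    padded_strict lam -> strict_partition mu -> all (leq 1) mu ->
    (size lam + size mu = n.*2)%N -> (size mu <= size lam)%N ->
  pfword (entry 0) n (word lam mu) =
    (lam == mu ++ nseq (size lam - size mu) 0%N)%:R.
Proof.
elim: lam n mu => [|p lam IHlam] n mu lamP muP mu0 sz le_sz.
  by case: mu sz {muP mu0} le_sz => //= sz _; case: n sz.
have [/allP plam lam_strict] := andP lamP.
have dead : p != 0%N -> p \notin mu -> pfword (entry 0) n (word (p :: lam) mu) = 0.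
  move=> p0 pmu; apply: (@pfword_dead _ _ _ (inl p)); first by rewrite mem_head.
  move=> z; rewrite mem_cat => /orP[] /mapP[q qin ->] /=; last first.
    rewrite mem_rev in qin; split=> //; case: eqP => // -[pq].
    by rewrite -pq (negPf pmu) in qin.
  rewrite (negPf p0) !eqseq_cons (negPf p0) andbF /= !if_same; split=> //.
case: mu muP mu0 sz le_sz dead => [|m mu] muP mu0 sz le_sz dead.
  (* All letters are empty rows: they cancel in pairs. *)
  have [pE | p0] := eqVneq p 0%N; last first.
    by rewrite dead // /= eqseq_cons (negPf p0).
  have lamE : lam = nseq (size lam) 0%N.
    apply/all_pred1P/allP => q /plam; rewrite pE ltn0 orbF => /eqP->.
    exact: eqxx.
  rewrite subn0 cat0s pE /= -lamE eqxx.
  have -> : word (0%N :: lam) [::] = nseq n.*2 (inl 0%N).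
    by rewrite /word cats0 -sz addn0 {1}lamE -map_nseq.
  by rewrite pfword_nseq /= expr1n.
have mmu : {in mu, forall q, (q < m)%N}.
  by apply/allP; apply: order_path_min muP => a b d /= ? ?; lia.
have m0 : (0 < m)%N by case/andP: mu0.
have wE lam' : word lam' (m :: mu) = rcons (word lam' mu) (inr m).
  by rewrite /word rev_cons map_rcons rcons_cat.
have [mp | pm | pm] := ltngtP m p.
- rewrite dead; last 2 first; [by lia | | by rewrite /= eqseq_cons gtn_eqF].
  by rewrite inE negb_or gtn_eqF //=; apply/negP => /mmu; lia.
- rewrite (@pfword_dead _ _ _ (inr m)); first by rewrite /= eqseq_cons ltn_eqF.
    by rewrite wE mem_rcons mem_head.
  move=> z; rewrite mem_cat => /orP[] /mapP[q qin ->] //=; split=> //.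
  rewrite eqseq_cons (_ : (q == m) = false) //; apply/eqP => qm; subst q.
  by move: qin; rewrite inE => /orP[/eqP|/plam]; lia.
- subst p; have [n' n'E] : exists n', n = n'.+1.
    by case: (n) sz => [|n'] //; exists n'.
  move: sz le_sz; rewrite n'E /= => sz le_sz.
  rewrite -/(word lam (m :: mu)) wE wcontract_rcons; last first.
    move=> z; rewrite mem_cat => /orP[] /mapP[q qin ->] /=.
      by rewrite eqseq_cons (gtn_eqF m0) if_same.
    rewrite mem_rev in qin; rewrite eqseq_cons (_ : (m == q) = false) //.
    by have := mmu _ qin; lia.
  have szw : size (word lam mu) = n'.*2.
    by rewrite size_cat !size_map size_rev; lia.
  rewrite szw -signr_odd odd_double mul1r [entry _ _ _]/= eqxx mul1r IHlam //.
  + by rewrite subSS eqseq_cons eqxx.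
  + exact: path_sorted muP.
  + by case/andP: mu0.
  + by rewrite -szw size_cat !size_map size_rev.
Qed.

(** Both sides obey the same recursion in t: on the right, the letter d + 1 with
d = c t becomes d + 1 plus x t times d, and the Pfaffian is linear in it. *)
Lemma growth_pfword t n lam mu :
    padded_strict lam -> strict_partition mu -> all (leq 1) mu ->
    (size lam + size mu = n.*2)%N -> (size mu <= size lam)%N ->
  growth (mu ++ nseq (size lam - size mu) 0%N) t lam =
    pfword (entry t) n (word lam mu).
Proof.
move=> + muP mu0; elim: t lam => [|t IHt] lam lamP sz le_sz.
  by rewrite pfword_entry0.
set d := c t; rewrite [LHS]/= -/d.
have [dlam | dnlam] := boolP (d.+1 \in lam); last first.
  rewrite /removable (negPf dnlam) addr0 IHt //; apply: eq_pfword => y z.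
  have nd y' : y' \in word lam mu -> y' != inl d.+1.
    rewrite mem_cat => /orP[] /mapP[q qin ->] //.
    by apply/negP => /eqP[qE]; rewrite qE (negPf dnlam) in qin.
  by move=> /nd yd /nd zd; rewrite entry_other.
have [u [v [lamE ud dv puv]]] := padded_strict_split lamP dlam.
have wE p : word (u ++ p :: v) mu =
    map inl u ++ inl p :: (map inl v ++ map inr (rev mu)).
  by rewrite /word map_cat /= -catA.
rewrite lamE wE (@pfword_row_add _ _ (entry t) _ (x t) _ (inl d)).
- rewrite -!wE -lamE -IHt //; congr (_ + _).
  case: ifPn => [rem | nrem].
    have szE : size (u ++ d :: v) = size lam by rewrite lamE !size_cat.
    have lowP : padded_strict (u ++ d :: v).
      by rewrite -(lower_split ud dv) -lamE padded_strict_lower.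
    by rewrite [in lower _ _]lamE lower_split // -IHt ?szE.
  move: nrem; rewrite lamE removable_split // negb_or negbK => /andP[d0 dinv].
  (* Since lam is strict, the row of length d comes right after that of length
     d + 1: after the replacement the two letters d are neighbours. *)
  case: v dinv {wE} dv puv lamE => [//|q v] dqv /= /andP[qd dv] puv lamE.
  have qE : q = d.
    move: puv; rewrite /padded_strict pairwise_cat /= => /and4P[_ _ /allP qv _].
    move: dqv; rewrite inE => /orP[/eqP -> //|/qv] /=; lia.
  have [n' n'E] : exists n', n = n'.+1.
    by case: (n) sz => [|n'] //; [rewrite lamE size_cat addnS|exists n'].
  rewrite qE n'E.
  have -> : word (u ++ d :: d :: v) mu =
      map inl u ++ [:: inl d, inl d & map inl v ++ map inr (rev mu)].
    by rewrite /word map_cat /= -catA.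
  by rewrite pfword_double [entry _ _ _]/= ltnn (negPf d0) mul0r mulr0.
- by move=> _ /mapP[p /(allP ud) /= pd ->]; apply: entry_col.
- move=> z; rewrite mem_cat => /orP[] /mapP[q qin ->].
    by apply: entry_row; apply: (allP dv).
  exact: entry_row_mu.
- have nd y' : y' \in map inl u ++ (map inl v ++ map inr (rev mu)) -> y' != inl d.+1.
    rewrite !mem_cat => /or3P[] /mapP[q qin ->] //; apply/negP => /eqP[qE].
      by have := allP ud _ qin; rewrite /= qE ltnn.
    by have := allP dv _ qin; rewrite /= qE ltnn.
  by move=> y z /nd yd /nd zd; rewrite entry_other.
Qed.

End Growth.

(** * Summing over fillings by times *)

Lemma padded_strict_gap lam i j :
    padded_strict lam -> (i <= j)%N ->
  nth 0%N lam j = 0%N \/ (nth 0%N lam j + (j - i) <= nth 0%N lam i)%N.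
Proof.
elim: lam i j => [|p lam IHlam] i [|j].
- by move=> _ _; left.
- by move=> _ _; left.
- by case: i => // _ _; right; rewrite subn0 addn0.
case: i => [|i]; last by case/andP => _ lamP ij; rewrite subSS; apply: IHlam.
case/andP=> /allP plam lamP _ /=.
have [jlam | lamj] := ltnP j (size lam); last by left; rewrite nth_default.
have plamj k : (k < size lam)%N -> (nth 0 lam k == 0)%N || (nth 0 lam k < p)%N.
  by move=> /(mem_nth 0%N); apply: plam.
case: j jlam => [|j] jlam; first by have := plamj _ jlam; lia.
have := IHlam 0%N j.+1 lamP isT.
by have := plamj _ (leq_ltn_trans (leq0n _) jlam); lia.
Qed.

Lemma nth_lower d lam i :
  nth 0%N (lower d lam) i = if nth 0%N lam i == d.+1 then d else nth 0%N lam i.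
Proof.
have [ilam | lami] := ltnP i (size lam); first by rewrite (nth_map 0%N).
by rewrite !nth_default ?size_lower.
Qed.

(** A box is given by its row i and its diagonal d, in a fixed rectangle of cells;
cells outside of the skew shape carry the value T, which is not a time. In this way
fillings of different shapes are functions of the same type, and a box is removed by
overwriting its value. *)
Section TimeFillings.
Variables (K : comNzRingType) (c : nat -> nat) (x : nat -> K).
Variables (r D T : nat) (mu : seq nat).
Hypotheses (mu_strict : padded_strict mu) (size_mu : size mu = r).

Local Notation cell := ('I_r * 'I_D)%type.
Implicit Types (b : cell) (lam : seq nat) (F : {ffun cell -> 'I_T.+1}).

Definition in_skew lam b : bool := (nth 0 mu b.1 <= b.2 < nth 0 lam b.1)%N.

(** To the right in the same row, or below in the same column: the column of a box
is its row plus its diagonal. *)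
Definition cell_before b b' : bool :=
  ((b.1 == b'.1) && (b.2 < b'.2)%N) ||
  ((b.1 < b'.1)%N && (b.1 + b.2 == b'.1 + b'.2)%N).

Definition time_filling t lam F : bool :=
  [&& [forall i : 'I_r, nth 0 mu i <= nth 0 lam i]%N,
      [forall b, if in_skew lam b then (F b < t)%N && (c (F b) == b.2)
                 else F b == T :> nat]
    & [forall b, forall b', [&& in_skew lam b, in_skew lam b' & cell_before b b']
         ==> (F b < F b')%N]].

Lemma time_fillingP t lam F :
  reflect [/\ forall i : 'I_r, (nth 0 mu i <= nth 0 lam i)%N,
              forall b, in_skew lam b -> (F b < t)%N /\ c (F b) = b.2,
              forall b, ~~ in_skew lam b -> F b = T :> nat
            & forall b b', in_skew lam b -> in_skew lam b' -> cell_before b b' ->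
                (F b < F b')%N]
          (time_filling t lam F).
Proof.
apply: (iffP and3P) => [[/forallP sub /forallP val /'forall_'forall_implyP mono] |
                        [sub val out mono]]; split=> //.
- by move=> b bin; have := val b; rewrite bin => /andP[-> /eqP].
- by move=> b /negPf bout; have := val b; rewrite bout => /eqP.
- by move=> b b' bin b'in bb'; apply: mono; rewrite bin b'in.
- exact/forallP.
- apply/forallP => b; case: ifPn => [/val[-> ->] | /out ->]; rewrite ?eqxx //.
- by apply/'forall_'forall_implyP => b b' /and3P[]; apply: mono.
Qed.

(** A box which carries the largest time t has no box to its right and none below
it, so its row ends there and the next row is shorter by at least 2. *)
Lemma last_cell_corner t lam F b :
    (t < T)%N -> padded_strict lam -> size lam = r ->
    (forall i : 'I_r, nth 0 lam i <= D)%N ->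
    time_filling t.+1 lam F -> F b = t :> nat ->
  [/\ in_skew lam b, nth 0 lam b.1 = b.2.+1, b.2 = c t :> nat
    & removable (c t) lam].
Proof.
move=> tT lamP size_lam lamD /time_fillingP[sub val out mono] Fb.
have bin : in_skew lam b.
  by apply/negPn/negP => /out; rewrite Fb => /eqP; rewrite ltn_eqF.
have maxb b' : in_skew lam b' -> cell_before b b' -> False.
  by move=> b'in /(mono _ _ bin b'in); have [] := val _ b'in; lia.
have [_ cb] := val _ bin; rewrite Fb in cb.
have /andP[mub lamb] := bin.
have lambE : nth 0%N lam b.1 = b.2.+1.
  apply/eqP; rewrite eqn_leq lamb andbT leqNgt; apply/negP => lamb'.
  have bD : (b.2.+1 < D)%N by apply: leq_trans (lamD b.1).
  apply: (maxb (b.1, Ordinal bD)).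
    by rewrite /in_skew /= lamb' (leq_trans mub).
  by rewrite /cell_before /= eqxx ltnSn.
split=> //; rewrite /removable cb -lambE mem_nth ?size_lam //=.
rewrite -implyNb; apply/implyP => d0; apply/negP => /(nthP 0%N)[j jlam].
move=> /(fun e => e : nth 0%N lam j = b.2 :> nat) lamj.
have ij : (b.1 < j)%N.
  rewrite ltnNge; apply/negP => ji; have := padded_strict_gap lamP ji; lia.
have jE : j = b.1.+1 by have := padded_strict_gap lamP (ltnW ij); lia.
have jr : (j < r)%N by rewrite -size_lam.
have dD : (b.2.-1 < D)%N by apply: leq_ltn_trans (leq_pred _) (ltn_ord _).
apply: (maxb (Ordinal jr, Ordinal dD)).
  rewrite /in_skew /= lamj; have := padded_strict_gap mu_strict (ltnW ij); lia.
rewrite /cell_before /=; lia.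
Qed.

Definition set_time b (v : 'I_T.+1) F : {ffun cell -> 'I_T.+1} :=
  [ffun b' => if b' == b then v else F b'].

Definition filling_weight lam F : K := \prod_(b | in_skew lam b) x (F b).

Lemma sum_time_filling0 lam :
    size lam = r -> (forall i : 'I_r, nth 0 lam i <= D)%N ->
  \sum_(F | time_filling 0 lam F) filling_weight lam F = (lam == mu)%:R.
Proof.
move=> size_lam lamD; have [-> | lam_mu] := eqVneq lam mu.
  have out b : in_skew mu b = false by rewrite /in_skew; lia.
  rewrite (bigD1 [ffun => ord_max]) /=; last first.
    apply/time_fillingP; split=> // b; rewrite ?out // => _.
    by rewrite ffunE.
  rewrite /filling_weight big_pred0 // big1 ?addr0 // => F.
  case/andP => /time_fillingP[_ _ Fout _] /eqP[].
  by apply/ffunP => b; rewrite ffunE; apply: val_inj; rewrite /= Fout ?out.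
rewrite big_pred0 // => F; apply/negP => /time_fillingP[sub val _ _].
case/eqP: lam_mu; apply: (@eq_from_nth _ 0%N) => [|i]; rewrite ?size_lam ?size_mu //.
move=> ir; have /= := sub (Ordinal ir); rewrite leq_eqVlt => /predU1P[-> //| mulam].
have iD : (nth 0%N mu i < D)%N by apply: leq_trans (lamD (Ordinal ir)).
by have [] // := val (Ordinal ir, Ordinal iD); rewrite /in_skew /= leqnn.
Qed.

(** Fillings which do not use the last time t give the first term of the recursion.
The others use it in exactly one box, the corner on the diagonal c t, and removing
this box is a bijection to the fillings of the smaller shape by the earlier times. *)
Lemma sum_time_filling t lam :
    (t <= T)%N -> padded_strict lam -> size lam = r ->
    (forall i : 'I_r, nth 0 lam i <= D)%N ->
  \sum_(F | time_filling t lam F) filling_weight lam F = growth c x mu t lam.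
Proof.
elim: t lam => [|t IHt] lam tT lamP size_lam lamD.
  by rewrite sum_time_filling0.
rewrite (bigID (fun F => [exists b, F b == t :> nat])) /= addrC; congr (_ + _).
  rewrite -IHt ?(ltnW tT) //; apply: eq_bigl => F.
  apply/andP/idP => [[/time_fillingP[sub val out mono]] | ].
    rewrite negb_exists => /forallP nt; apply/time_fillingP; split=> // b bin.
    have [Fbt cFb] := val _ bin; split=> //.
    by have := nt b; rewrite ltn_neqAle => ->.
  move=> /time_fillingP[sub val out mono]; split.
    apply/time_fillingP; split=> // b bin; have [Fbt cFb] := val _ bin.
    by split=> //; apply: ltnW.
  rewrite negb_exists; apply/forallP => b.
  have [/val[] | /out ->] := boolP (in_skew lam b); by lia.
case: ifPn => [rem | nrem]; last first.
  rewrite big_pred0 // => F; apply/negP => /andP[FP /existsP[b /eqP Fb]].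
  by have [_ _ _] := last_cell_corner tT lamP size_lam lamD FP Fb; apply/negP.
set d := c t in rem *.
have /andP[dlam _] := rem.
have i0r : (index d.+1 lam < r)%N by rewrite -size_lam index_mem.
have lam0 : nth 0%N lam (Ordinal i0r) = d.+1 by rewrite nth_index.
set i0 := Ordinal i0r in lam0.
have dD : (d < D)%N by rewrite -lam0.
pose b0 : cell := (i0, Ordinal dD).
have lam_uniq i : nth 0%N lam i = d.+1 -> i = i0.
  move=> lami; have [ii0|i0i|//] := ltngtP i i0.
    by have := padded_strict_gap lamP (ltnW ii0); lia.
  by have := padded_strict_gap lamP (ltnW i0i); lia.
have lowP := padded_strict_lower lamP rem.
have low0 : nth 0%N (lower d lam) i0 = d by rewrite nth_lower lam0 eqxx.
have low_other i : i != i0 :> nat -> nth 0%N (lower d lam) i = nth 0%N lam i.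
  move=> ii0; rewrite nth_lower; case: eqP => // /lam_uniq iE.
  by rewrite iE eqxx in ii0.
have low_le i : (nth 0 (lower d lam) i <= nth 0 lam i)%N.
  by rewrite nth_lower; case: eqP => // ->.
rewrite -IHt ?(ltnW tT) ?size_lower // => [|i]; last exact: leq_trans (lamD i).
have in_low b : in_skew (lower d lam) b = in_skew lam b && (b != b0).
  rewrite /in_skew; have [bi | bi] := eqVneq (val b.1) i0.
    have -> : (b != b0) = (b.2 != d :> nat).
      congr negb; rewrite -pair_eqE /pair_eq /= -!val_eqE /= bi eqxx //.
    by rewrite bi low0 lam0; lia.
  rewrite low_other // (_ : b != b0) ?andbT //.
  by apply: contra_neq bi => ->.
have tE : (inord t : 'I_T.+1) = t :> nat by rewrite inordK // ltnS ltnW.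
have corner F b : time_filling t.+1 lam F -> F b = t :> nat -> b = b0 /\ in_skew lam b.
  move=> FP Fb; have [bin lamb bd _] := last_cell_corner tT lamP size_lam lamD FP Fb.
  split=> //; rewrite bd -/d in lamb.
  case: b lamb bd {Fb bin} => i e /= /lam_uniq iE eE.
  by congr (_, _); apply: val_inj.
pose ins := set_time b0 (inord t); pose del := set_time b0 ord_max.
rewrite (reindex_onto ins del) => [|F /andP[FP /existsP[b /eqP Fb]]]; last first.
  apply/ffunP => b'; rewrite !ffunE; case: eqP => // ->.
  by apply: val_inj; rewrite /= tE -Fb; have [-> _] := corner _ _ FP Fb.
rewrite mulr_sumr; apply: eq_big => [F|F].
  apply/andP/idP => [[/andP[FP _] /eqP delF] | /time_fillingP[sub val out mono]].
    have insb b : b != b0 -> ins F b = F b by rewrite ffunE => /negPf->.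
    have insb0 : ins F b0 = t :> nat by rewrite ffunE eqxx tE.
    have [_ b0in] := corner _ _ FP insb0.
    have /time_fillingP[sub val out mono] := FP.
    apply/time_fillingP; split.
    - move=> i; have [->|ii0] := eqVneq i i0; last by rewrite low_other.
      by rewrite low0; case/andP: b0in.
    - move=> b; rewrite in_low => /andP[bin bb0]; rewrite -insb //.
      have [Ft cF] := val _ bin; split=> //; rewrite ltn_neqAle -ltnS Ft andbT.
      by apply: contra bb0 => /eqP /(corner _ _ FP)[->].
    - move=> b; rewrite in_low negb_and negbK => /orP[bout|/eqP ->].
        rewrite -insb ?out //; by apply: contraNneq bout => ->.
      by rewrite -delF ffunE eqxx.
    - move=> b b'; rewrite !in_low => /andP[bin bb0] /andP[b'in b'b0].
      by rewrite -!insb //; apply: mono.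
  have b0in : in_skew lam b0.
    rewrite /in_skew lam0 leqnn andbT; have := sub i0; rewrite low0 //.
  have insP : time_filling t.+1 lam (ins F).
    apply/time_fillingP; split.
    - by move=> i; apply: leq_trans (low_le i).
    - move=> b bin; rewrite ffunE; case: eqVneq => [->|bb0]; first by rewrite tE.
      have [] := val b; first by rewrite in_low bin.
      by move=> Ft ->; split=> //; apply: ltnW.
    - move=> b bout; rewrite ffunE; case: eqVneq => [bb0|bb0].
        by rewrite bb0 b0in in bout.
      by rewrite out // in_low (negPf bout).
    - move=> b b' bin b'in bb'; rewrite !ffunE.
      have [bE | bb0] := eqVneq b b0.
        exfalso; move: bb' b'in; rewrite bE /cell_before /in_skew /= -val_eqE /=.
        case/orP => /andP[].
          by move=> /eqP <- db' /andP[_]; rewrite lam0; lia.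
        move=> i0b' /eqP sumE /andP[_]; have := padded_strict_gap lowP (ltnW i0b').
        rewrite low0 low_other; last by rewrite gtn_eqF.
        lia.
      have [b'E | b'b0] := eqVneq b' b0.
        by rewrite tE; case: (val b) => //; rewrite in_low bin.
      by apply: mono; rewrite ?in_low ?bin ?b'in.
  split.
    by rewrite insP; apply/existsP; exists b0; rewrite ffunE eqxx tE.
  apply/eqP/ffunP => b; rewrite !ffunE; case: eqVneq => // ->.
  by apply: val_inj; rewrite /= out // in_low eqxx andbF.
case/andP => /andP[FP _] _.
have insb0 : ins F b0 = t :> nat by rewrite ffunE eqxx tE.
have [_ b0in] := corner _ _ FP insb0.
rewrite /filling_weight (bigD1 b0) //= insb0; congr (_ * _).
rewrite (eq_bigl (in_skew (lower d lam))) => [|b]; last by rewrite in_low.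
apply: eq_bigr => b; rewrite in_low => /andP[_ bb0].
by rewrite ffunE (negPf bb0).
Qed.

End TimeFillings.

(** * Marked shifted tableaux as fillings by times *)

(** The position of a letter in 1' < 1 < 2' < 2 < ..., which are coded by
(0, false), (0, true), (1, false), (1, true), ... *)
Definition mark_rank (m : marked) : nat := (m.1.*2 + m.2)%N.

Lemma mark_rank_inj : injective mark_rank.
Proof.
move=> [k e] [k' e']; rewrite /mark_rank /= => eq_rank.
have ee' : e = e' by have := congr1 odd eq_rank; rewrite !oddD !odd_double !oddb.
by rewrite ee' in eq_rank *; congr (_, _); lia.
Qed.

Lemma le_mark_rank (m m' : marked) : (m <= m')%O = (mark_rank m <= mark_rank m')%N.
Proof.
case: m m' => [k e] [k' e']; rewrite Order.ProdLexiOrder.leEprodlexi /mark_rank /=.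
rewrite !leEnat; case: e e' => [] [] /=; rewrite ?Order.BoolOrder.leEbool /=; lia.
Qed.

Section Times.
Variable D : nat.

(** Blocks of D times, one block per letter. Within the block of a primed letter the
diagonals decrease, because equal primed letters may follow each other down a column
only; within the block of an unprimed letter they increase, because equal unprimed
letters may follow each other along a row only. *)
Definition time (m : marked) (d : nat) : nat :=
  (mark_rank m * D + (if m.2 then d else D.-1 - d))%N.

Definition time_mark (t : nat) : marked := ((t %/ D)./2, odd (t %/ D))%N.

Definition time_content (t : nat) : nat :=
  (if odd (t %/ D) then t %% D else D.-1 - t %% D)%N.

Lemma time_div m d : (d < D)%N -> (time m d %/ D = mark_rank m)%N.
Proof.
move=> dD; rewrite /time divnMDl; last by lia.
by rewrite divn_small ?addn0 //; case: m.2; lia.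
Qed.

Lemma time_mod m d : (d < D)%N -> (time m d %% D = if m.2 then d else D.-1 - d)%N.
Proof.
by move=> dD; rewrite /time modnMDl modn_small //; case: m.2; lia.
Qed.

Lemma odd_mark_rank m : odd (mark_rank m) = m.2.
Proof. by rewrite /mark_rank oddD odd_double oddb. Qed.

Lemma time_markK m d : (d < D)%N -> time_mark (time m d) = m.
Proof.
move=> dD; rewrite /time_mark time_div // odd_mark_rank; case: m => k e.
by rewrite /mark_rank /= addnC half_bit_double.
Qed.

Lemma time_contentK m d : (d < D)%N -> time_content (time m d) = d.
Proof.
move=> dD; rewrite /time_content time_div // time_mod // odd_mark_rank.
by case: m.2 => //; lia.
Qed.

Lemma time_mark_content t : (0 < D)%N -> time (time_mark t) (time_content t) = t.
Proof.
move=> D0; rewrite /time /time_mark /time_content /mark_rank /=.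
rewrite addnC (addnC _./2.*2) odd_double_half [RHS](divn_eq t D) addnC.
congr (_ + _)%N; have := ltn_pmod t D0; case: (odd _) => //; lia.
Qed.

Lemma time_lt_bound N m d : (d < D)%N -> (time m d < N.*2 * D)%N = (m.1 < N)%N.
Proof.
move=> dD; rewrite -ltn_divLR; last by lia.
by rewrite time_div // /mark_rank; case: m => k [] /=; lia.
Qed.

Lemma ltn_time m m' d d' : (d < D)%N -> (d' < D)%N ->
  (time m d < time m' d')%N =
    (mark_rank m < mark_rank m')%N ||
    (mark_rank m == mark_rank m') && (if m.2 then d < d' else d' < d)%N.
Proof.
move=> dD d'D; case: (ltngtP (mark_rank m) (mark_rank m')) => [lt|gt|/mark_rank_inj ->] /=.
- rewrite /time; have := leq_mul2r D (mark_rank m).+1 (mark_rank m').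
  by rewrite lt orbT mulSn; case: m.2; case: m'.2; lia.
- rewrite /time; have := leq_mul2r D (mark_rank m').+1 (mark_rank m).
  by rewrite gt orbT mulSn; case: m.2; case: m'.2; lia.
- by rewrite /time ltn_add2l; case: m'.2; lia.
Qed.

End Times.

Lemma mem_SDskew lam mu i j :
  ((i, j) \in SDskew lam mu) =
  [&& 0 < i <= size lam, i <= j & nth 0 mu i.-1 <= j - i < nth 0 lam i.-1]%N.
Proof.
rewrite /SDskew in_fsetD !mem_SD.
have [imu | mui] := leqP i (size mu); last first.
  by rewrite (nth_default _ (_ : size mu <= i.-1)%N); lia.
lia.
Qed.

(** The offset o shifts all diagonals. It allows a straight row with k boxes to be
read as the skew row of shape (o + k)/(o), which is how the entries of the block H
arise; lam' and mu' are the shifted shapes. *)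
Section Encoding.
Variables (lam mu : seq nat) (o D N : nat) (lam' mu' : seq nat).
Hypothesis lam'E : forall i, (i < size lam)%N -> nth 0%N lam' i = (o + nth 0 lam i)%N.
Hypothesis mu'E : forall i, (i < size lam)%N -> nth 0%N mu' i = (o + nth 0 mu i)%N.
Hypothesis lam'D : forall i, (nth 0 lam' i <= D)%N.
Hypothesis D_gt0 : (0 < D)%N.
Hypothesis sub_mu : forall i, (nth 0 mu i <= nth 0 lam i)%N.

Local Notation r := (size lam).
Local Notation box := (SDskew lam mu).
Local Notation cell := ('I_r * 'I_D)%type.
Local Notation T := (N.*2 * D)%N.
Implicit Types (b : box) (G : {ffun box -> marked}) (F : {ffun cell -> 'I_T.+1}).

Definition box_row b : nat := (fsval b).1.
Definition box_col b : nat := (fsval b).2.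
Definition box_diag b : nat := (box_col b - box_row b)%N.

Lemma boxP b : [&& 0 < box_row b <= r, box_row b <= box_col b
  & nth 0 mu (box_row b).-1 <= box_diag b < nth 0 lam (box_row b).-1]%N.
Proof.
by rewrite /box_diag /box_row /box_col; move: (fsvalP b) => /=; case: (fsval b) => i j; rewrite mem_SDskew.
Qed.

Lemma box_row_proof b : ((box_row b).-1 < r)%N.
Proof. by have := boxP b; lia. Qed.

Lemma box_content_proof b : (o + box_diag b < D)%N.
Proof.
have := lam'D (box_row b).-1; rewrite lam'E ?box_row_proof //.
by have := boxP b; lia.
Qed.

Lemma box_inj b b' : box_row b = box_row b' -> box_col b = box_col b' -> b = b'.
Proof.
rewrite /box_row /box_col => e1 e2; apply: val_inj; move: e1 e2 => /=.
by case: (fsval b) (fsval b') => ? ? [? ?] /= -> ->.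
Qed.

Definition cell_of b : cell :=
  (Ordinal (box_row_proof b), Ordinal (box_content_proof b)).

Lemma cell_of_inj : injective cell_of.
Proof.
move=> b b' [] /= e1 e2; apply: box_inj; move: e1 e2 (boxP b) (boxP b').
  by lia.
by rewrite /box_diag; lia.
Qed.

Lemma cell_of_in_skew b : in_skew mu' lam' (cell_of b).
Proof.
have ir := box_row_proof b; rewrite /in_skew /= lam'E // mu'E // leq_add2l ltn_add2l.
by case/and3P: (boxP b).
Qed.

Lemma in_skew_cell_of (e : cell) : in_skew mu' lam' e -> exists b, cell_of b = e.
Proof.
case: e => i d; rewrite /in_skew /= lam'E // mu'E // => /andP[lo hi].
have inS : (i.+1, i.+1 + (d - o))%N \in SDskew lam mu.
  by rewrite mem_SDskew /=; have := ltn_ord i; lia.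
exists [` inS]%fset; congr (_, _); apply: val_inj; rewrite //= /box_diag /box_col /box_row /=; lia.
Qed.

Definition box_time G b : nat := time D (G b) (o + box_diag b)%N.

Lemma is_QSST_rowcol G :
  is_QSST G =
  [&& [forall b : box, forall b' : box,
         (box_row b == box_row b') && (box_col b <= box_col b')%N ==> (G b <= G b')%O],
      [forall b : box, forall b' : box,
         (box_col b == box_col b') && (box_row b <= box_row b')%N ==> (G b <= G b')%O],
      [forall b : box, forall b' : box,
         [&& box_row b == box_row b', G b == G b' & is_primed (G b)] ==> (b == b')]
    & [forall b : box, forall b' : box,
         [&& box_col b == box_col b', G b == G b' & ~~ is_primed (G b)] ==> (b == b')]].
Proof. by []. Qed.

(** For boxes with different letters both sides compare the letters. For boxes with
the same letter, times increase along a row exactly if the letter is unprimed, and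
down a column exactly if it is primed. *)
Lemma is_QSST_time G :
  is_QSST G = [forall b : box, forall b' : box,
    cell_before (cell_of b) (cell_of b') ==> (box_time G b < box_time G b')%N].
Proof.
have beforeE b b' : cell_before (cell_of b) (cell_of b') =
   (box_row b == box_row b') && (box_col b < box_col b')%N ||
   (box_col b == box_col b') && (box_row b < box_row b')%N.
  rewrite /cell_before -val_eqE /= /box_diag; have := boxP b; have := boxP b'; rewrite /box_diag; lia.
have contentD b := box_content_proof b.
rewrite is_QSST_rowcol.
apply/and4P/'forall_'forall_implyP => [[] | H].
  move=> /'forall_'forall_implyP rowP /'forall_'forall_implyP colP.
  move=> /'forall_'forall_implyP primed /'forall_'forall_implyP unprimed b b'.
  rewrite beforeE /box_time ltn_time // => /orP[]/andP[/eqP e lt].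
    have := rowP b b'; rewrite e eqxx ltnW // le_mark_rank => /(_ isT).
    rewrite leq_eqVlt => /orP[/eqP/mark_rank_inj Geq|-> //].
    rewrite Geq eqxx ltnn /=; case: ifPn => [_|nm].
      by rewrite /box_diag e; have := boxP b; have := boxP b'; rewrite /box_diag; lia.
    have := primed b b'; rewrite e Geq !eqxx /is_primed nm => /(_ isT)/eqP bb'.
    by rewrite bb' ltnn in lt.
  have := colP b b'; rewrite e eqxx ltnW // le_mark_rank => /(_ isT).
  rewrite leq_eqVlt => /orP[/eqP/mark_rank_inj Geq|-> //].
  rewrite Geq eqxx ltnn /=; case: ifPn => [m|_].
    have := unprimed b b'; rewrite e Geq !eqxx /is_primed negbK m => /(_ isT)/eqP bb'.
    by rewrite bb' ltnn in lt.
  by rewrite /box_diag e; have := boxP b; have := boxP b'; rewrite /box_diag; lia.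
have timeP b b' : cell_before (cell_of b) (cell_of b') ->
    (mark_rank (G b) < mark_rank (G b'))%N || (G b == G b') &&
     (if (G b).2 then box_diag b < box_diag b' else box_diag b' < box_diag b)%N.
  by move=> /H; rewrite /box_time ltn_time // !ltn_add2l (inj_eq mark_rank_inj).
split; apply/'forall_'forall_implyP => b b'.
- move=> /andP[/eqP e1]; rewrite leq_eqVlt => /orP[/eqP e2|lt].
    by rewrite (box_inj e1 e2) lexx.
  rewrite le_mark_rank; have /timeP/orP[/ltnW//|/andP[/eqP->//]] :
    cell_before (cell_of b) (cell_of b') by rewrite beforeE e1 eqxx lt.
- move=> /andP[/eqP e2]; rewrite leq_eqVlt => /orP[/eqP e1|lt].
    by rewrite (box_inj e1 e2) lexx.
  rewrite le_mark_rank; have /timeP/orP[/ltnW//|/andP[/eqP->//]] :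
    cell_before (cell_of b) (cell_of b') by rewrite beforeE e2 eqxx lt orbT.
- case/and3P => /eqP e1 /eqP Geq np; apply/eqP/box_inj => //.
  have [lt|lt|//] := ltngtP (box_col b) (box_col b').
    have /timeP : cell_before (cell_of b) (cell_of b') by rewrite beforeE e1 eqxx lt.
    by rewrite Geq ltnn -Geq (negPf np) /box_diag e1; have := boxP b; have := boxP b'; rewrite /box_diag; lia.
  have /timeP : cell_before (cell_of b') (cell_of b) by rewrite beforeE e1 eqxx lt.
  by rewrite -Geq ltnn (negPf np) /box_diag e1; have := boxP b; have := boxP b'; rewrite /box_diag; lia.
- case/and3P => /eqP e2 /eqP Geq; rewrite negbK => np; apply/eqP/box_inj => //.
  have [lt|lt|//] := ltngtP (box_row b) (box_row b').
    have /timeP : cell_before (cell_of b) (cell_of b') by rewrite beforeE e2 eqxx lt orbT.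
    by rewrite Geq ltnn -Geq np /box_diag e2; have := boxP b; have := boxP b'; rewrite /box_diag; lia.
  have /timeP : cell_before (cell_of b') (cell_of b) by rewrite beforeE e2 eqxx lt orbT.
  by rewrite -Geq ltnn np /box_diag e2; have := boxP b; have := boxP b'; rewrite /box_diag; lia.
Qed.

Definition fill G : {ffun cell -> 'I_T.+1} :=
  [ffun e : cell => if [pick b | cell_of b == e] is Some b then inord (box_time G b)
                    else ord_max].

Definition unfill F : {ffun box -> marked} := [ffun b => time_mark D (F (cell_of b))].

Lemma fill_cell_of G b : fill G (cell_of b) = inord (box_time G b).
Proof.
rewrite ffunE; case: pickP => [b' /eqP/cell_of_inj -> //|/(_ b)].
by rewrite eqxx.
Qed.

Local Notation tf := (time_filling (time_content D) mu' T lam').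

Lemma unfill_time F b : tf F -> box_time (unfill F) b = F (cell_of b).
Proof.
case/time_fillingP => _ val _ _; have [_ cF] := val _ (cell_of_in_skew b).
by rewrite /box_time ffunE -[(o + _)%N]/(nat_of_ord (cell_of b).2) -cF time_mark_content.
Qed.

Lemma unfill_QSST F : tf F -> is_QSST (unfill F).
Proof.
move=> FP; rewrite is_QSST_time; apply/'forall_'forall_implyP => b b' bb'.
rewrite !unfill_time //; case/time_fillingP: FP => _ _ _ mono.
by apply: mono => //; apply: cell_of_in_skew.
Qed.

Lemma unfill_bound F b : tf F -> ((unfill F b).1 < N)%N.
Proof.
move=> FP; rewrite -(time_lt_bound _ _ (box_content_proof b)).
rewrite -/(box_time _ _) unfill_time //.
by case/time_fillingP: FP => _ val _ _; case: (val _ (cell_of_in_skew b)).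
Qed.

Lemma unfill_inj : {in tf &, injective unfill}.
Proof.
move=> F F' FP F'P eqFF'; apply/ffunP => e; apply: val_inj => /=.
have [/in_skew_cell_of[b <-] | out] := boolP (in_skew mu' lam' e).
  by rewrite -!unfill_time // eqFF'.
case/time_fillingP: FP => _ _ -> // _.
by case/time_fillingP: F'P => _ _ -> // _.
Qed.

Lemma fill_val G b : (forall b, ((G b).1 < N)%N) -> fill G (cell_of b) = box_time G b :> nat.
Proof.
move=> GN; rewrite fill_cell_of inordK // ltnS ltnW //.
by rewrite /box_time time_lt_bound // box_content_proof.
Qed.

Lemma fillP G : is_QSST G -> (forall b, ((G b).1 < N)%N) -> tf (fill G).
Proof.
move=> GP GN; apply/time_fillingP; split.
- by move=> i; rewrite lam'E // mu'E // leq_add2l.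
- move=> _ /in_skew_cell_of[b <-]; rewrite fill_val //.
  by rewrite time_lt_bound ?box_content_proof // time_contentK ?box_content_proof.
- move=> e; rewrite ffunE; case: pickP => // b /eqP <-.
  by rewrite cell_of_in_skew.
- move=> _ _ /in_skew_cell_of[b <-] /in_skew_cell_of[b' <-] bb'.
  rewrite !fill_val //; move: GP; rewrite is_QSST_time.
  by move=> /'forall_'forall_implyP; apply.
Qed.

Lemma fillK G : (forall b, ((G b).1 < N)%N) -> unfill (fill G) = G.
Proof.
move=> GN; apply/ffunP => b; rewrite ffunE fill_val //.
by rewrite time_markK // box_content_proof.
Qed.

(** The finite set A, which consists of the tableaux with all entries at most N, is
part of the statement because the tableaux themselves form an infinite type. *)
Lemma sum_QSST_growth (K : comNzRingType) (w : nat -> nat -> K) :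
    padded_strict lam' -> padded_strict mu' -> size lam' = r -> size mu' = r ->
  exists A : {fset QSST lam mu},
    (forall M : QSST lam mu, (M \in A) = [forall b, (val M b).1 < N]%N) /\
    \sum_(M <- A) \prod_(b : box) w (o + box_diag b)%N (mark_abs (val M b)) =
      growth (time_content D) (fun t => w (time_content D t) (mark_abs (time_mark D t)))
        mu' T lam'.
Proof.
move=> lamP muP size_lam' size_mu'.
pose s : seq (QSST lam mu) := pmap insub [seq unfill F | F <- enum tf].
have sP (M : QSST lam mu) : (M \in s) = [forall b, (val M b).1 < N]%N.
  rewrite mem_pmap_sub; apply/mapP/forallP => [[F] | MN].
    by rewrite mem_enum => FP -> b; apply: unfill_bound.
  exists (fill (val M)); last by rewrite fillK.
  by rewrite mem_enum; apply: fillP => //; apply: valP.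
exists [fset M in s]%fset; split=> [M|]; first by rewrite inE /= sP.
rewrite (perm_big s) /=; last first.
  apply: uniq_perm => [||M]; rewrite ?fset_uniq ?inE //.
  apply: pmap_sub_uniq; rewrite map_inj_in_uniq ?enum_uniq // => F F'.
  by rewrite !mem_enum; apply: unfill_inj.
rewrite big_pmap big_map -(@sum_time_filling K _ _ r D T mu' muP size_mu') //.
rewrite big_enum /=; apply: eq_bigr => F FP.
rewrite insubT ?unfill_QSST //= => FQ.
rewrite /filling_weight (eq_bigl [in [set cell_of b | b : box]]) => [|e]; last first.
  apply/idP/imsetP => [/in_skew_cell_of[b <-] | [b _ ->]]; first by exists b.
  exact: cell_of_in_skew.
rewrite big_imset /=; last by move=> ? ? _ _; apply: cell_of_inj.
rewrite (eq_bigl predT) => [|b]; last by rewrite inE.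
apply: eq_bigr => b _; case/time_fillingP: (FP) => _ val _ _.
have [_ ->] := val _ (cell_of_in_skew b).
by rewrite ffunE.
Qed.

End Encoding.

(** * Absolutely convergent sums of complex numbers *)

Section Summation.
Local Open Scope classical_set_scope.
Variables (R : realType) (I : choiceType).

(** The limit is the supremum of the partial sums. *)
Lemma nneg_partial_sums (h : I -> R) (B : R) :
    (forall i, 0 <= h i) -> (forall J : {fset I}, \sum_(i <- J) h i <= B) ->
  exists l, forall e : R, 0 < e -> exists J0 : {fset I},
    forall J : {fset I}, (J0 `<=` J)%fset -> `|l - \sum_(i <- J) h i| < e.
Proof.
move=> h0 hB; pose S := [set (\sum_(i <- J) h i) | J in [set: {fset I}]]%classic.
have supS : has_sup S.
  split; first by exists (\sum_(i <- fset0) h i); exists fset0.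
  by exists B => _ [J _ <-].
exists (sup S) => e e0.
have [_ [J0 _ <-] J0P] := sup_adherent e0 supS.
exists J0 => J J0J.
have le_sup : \sum_(i <- J) h i <= sup S.
  by apply: ub_le_sup; [case: supS | exists J].
rewrite ger0_norm ?subr_ge0 // ltrBlDl -ltrBlDr; apply: lt_le_trans J0P _.
rewrite [leRHS](big_fsetID _ (mem J0)) /=.
have -> : [fset i in J | i \in J0]%fset = J0.
  by apply/fsetP => i; rewrite !inE andbC; case: (boolP (i \in J0)) => // /(fsubsetP J0J)->.
by rewrite lerDl sumr_ge0.
Qed.

Lemma normc_le_ReIm (z : R[i]) : Normc.normc z <= `|complex.Re z| + `|complex.Im z|.
Proof.
case: z => a b /=; rewrite -[leRHS]ger0_norm ?addr_ge0 // -sqrtr_sqr.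
rewrite ler_wsqrtr // sqrrD !real_normK ?num_real // lerD2r lerDl.
by rewrite mulrn_wge0 // mulr_ge0.
Qed.

Lemma Re_le_normc (z : R[i]) : `|complex.Re z| <= Normc.normc z.
Proof. by case: z => a b /=; rewrite -sqrtr_sqr ler_wsqrtr // lerDl sqr_ge0. Qed.

Lemma Im_le_normc (z : R[i]) : `|complex.Im z| <= Normc.normc z.
Proof. by case: z => a b /=; rewrite -sqrtr_sqr ler_wsqrtr // lerDr sqr_ge0. Qed.

(** The real part g of f is the difference of the nonnegative families |f| + g and
|f|, and likewise for the imaginary part. *)
Lemma complex_partial_sums (f : I -> R[i]) (B : R) :
    (forall J : {fset I}, \sum_(i <- J) Normc.normc (f i) <= B) ->
  exists L : R[i], forall e : R, 0 < e -> exists J0 : {fset I},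
    forall J : {fset I}, (J0 `<=` J)%fset -> Normc.normc (L - \sum_(i <- J) f i) < e.
Proof.
move=> fB.
have sumE (g : I -> R) (J : {fset I}) :
    \sum_(i <- J) g i = \sum_(i <- J) (Normc.normc (f i) + g i)
      - \sum_(i <- J) Normc.normc (f i).
  by rewrite big_split addrC addKr.
have part (g : I -> R) : (forall i, `|g i| <= Normc.normc (f i)) ->
    exists l, forall e : R, 0 < e -> exists J0 : {fset I},
      forall J : {fset I}, (J0 `<=` J)%fset -> `|l - \sum_(i <- J) g i| < e.
  move=> gf.
  have [||l0 l0P] := @nneg_partial_sums (fun i => Normc.normc (f i)) B.
  - by move=> i; apply: le_trans (gf i).
  - exact: fB.
  have [||l1 l1P] := @nneg_partial_sums (fun i => Normc.normc (f i) + g i) (B + B).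
  - move=> i; rewrite -lerBlDr sub0r.
    by apply: le_trans (gf i); rewrite -normrN ler_norm.
  - move=> J; rewrite big_split lerD //; apply: le_trans (fB J).
    by apply: ler_sum => i _; apply: le_trans (gf i); rewrite ler_norm.
  exists (l1 - l0) => e e0.
  have e20 : 0 < e / 2 by rewrite divr_gt0.
  have [J0 J0P] := l0P _ e20; have [J1 J1P] := l1P _ e20.
  exists (J0 `|` J1)%fset => J; rewrite fsubUset => /andP[/J0P lt0 /J1P lt1].
  rewrite sumE (_ : _ - _ = (l1 - \sum_(i <- J) (Normc.normc (f i) + g i))
    - (l0 - \sum_(i <- J) Normc.normc (f i))); last by ring.
  by rewrite (splitr e) (le_lt_trans (ler_normB _ _)) // ltrD.
have [lr lrP] := part _ (fun i => Re_le_normc (f i)).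
have [li liP] := part _ (fun i => Im_le_normc (f i)).
exists (Complex lr li) => e e0.
have e20 : 0 < e / 2 by rewrite divr_gt0.
have [J0 J0P] := lrP _ e20; have [J1 J1P] := liP _ e20.
exists (J0 `|` J1)%fset => J; rewrite fsubUset => /andP[/J0P lt0 /J1P lt1].
apply: le_lt_trans (normc_le_ReIm _) _; rewrite !raddfB !raddf_sum /= !sumrN.
by rewrite (splitr e) ltrD.
Qed.

Lemma abscvg_bound (f : I -> R[i]) :
    summable [set: I] (fun i => (Normc.normc (f i))%:E) ->
  exists B, forall J : {fset I}, \sum_(i <- J) Normc.normc (f i) <= B.
Proof.
rewrite summableE => /fineK sumE.
exists (fine (\esum_(i in [set: I]) `|(Normc.normc (f i))%:E|%E)) => J.
rewrite -lee_fin sumE; apply: esum_ge; exists [set` J]%classic.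
  by split=> //; apply: finite_fset.
rewrite -fsbig_seq ?fset_uniq //= sumEFin lee_fin.
by apply: ler_sum => i _; rewrite ler_norm.
Qed.

(** The sum is a limit over all finite sets of indices; a sequence of finite sets
which eventually contains each index computes it, since it eventually contains each
finite set. *)
Lemma abscvg_partial_sum_cvg (f : I -> R[i]) (A : nat -> {fset I}) :
    summable [set: I] (fun i => (Normc.normc (f i))%:E) ->
    (forall i, exists N0, forall N, (N0 <= N)%N -> i \in A N) ->
  (fun N => \sum_(i <- A N) f i : R[i]^o) @ \oo --> (summability.sum (f : I -> R[i]^o)).
Proof.
move=> /abscvg_bound[B fB] AP; have [L LP] := complex_partial_sums fB.
have normE (z : R[i]) (e : R[i]) : 0 < e -> (`|z : R[i]^o| < e) = (Normc.normc z < complex.Re e).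
  case: e => er ei; rewrite ltcE /= => /andP[/eqP ei0 _].
  by rewrite ltcE /= ei0 eqxx.
have gt0_Re (e : R[i]) : 0 < e -> 0 < complex.Re e.
  by rewrite ltcE => /andP[].
have FF : ProperFilter (@summability.totally I) := summability.totally_filter.
have sumL : summability.partial_sum (f : I -> R[i]^o) @ summability.totally --> (L : R[i]^o).
  apply/cvgrPdist_lt => e e0.
  have [J0 J0P] := LP (complex.Re e) (gt0_Re _ e0).
  exists J0 => // J J0J /=.
  rewrite normE // /summability.partial_sum -(big_seq_fsetE _ _ predT f); apply: J0P.
  exact: J0J.
rewrite /summability.sum (cvg_lim _ sumL) //.
apply/cvgrPdist_lt => e e0.
have [J0 J0P] := LP (complex.Re e) (gt0_Re _ e0).
have [N0 N0P] : exists N0, forall N, (N0 <= N)%N -> (J0 `<=` A N)%fset.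
  have /fin_all_exists[N0 N0P] : forall i : J0, exists N0,
    forall N, (N0 <= N)%N -> val i \in A N by move=> i; apply: AP.
  exists (\max_i N0 i) => N NN; apply/fsubsetP => i iJ0.
  apply: (N0P [` iJ0]%fset); apply: leq_trans NN.
  exact: (leq_bigmax [` iJ0]%fset).
exists N0 => // N /= NN; rewrite normE //; apply: J0P; exact: N0P.
Qed.

End Summation.

(** * Passing to the limit *)

Section PfwordContinuity.
Local Open Scope classical_set_scope.
Variables (K : numFieldType) (T : eqType).

Lemma cvg_wcontract (b_ : nat -> T -> K) (g_ : nat -> seq T -> K)
    (b : T -> K) (g : seq T -> K) (w : seq T) :
    {in w, forall z, b_ ^~ z @ \oo --> b z} ->
    (forall v, subseq v w -> g_ ^~ v @ \oo --> g v) ->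
  (fun N => wcontract (b_ N) (g_ N) w) @ \oo --> wcontract b g w.
Proof.
elim: w g_ g => [|y w IHw] g_ g bP gP; first exact: cvg_cst.
apply: cvgB.
  by apply: cvgM; [apply: bP; rewrite mem_head | apply: gP; rewrite subseq_cons].
apply: (IHw (fun N v => g_ N (y :: v)) (fun v => g (y :: v))) => [z zw | v vw].
  by apply: bP; rewrite inE zw orbT.
by apply: gP; rewrite /= eqxx.
Qed.

Lemma cvg_pfword (rel : rel T) (a_ : nat -> T -> T -> K)
    (a : T -> T -> K) n (w : seq T) :
    pairwise rel w ->
    {in w &, forall y z, rel y z -> (fun N => a_ N y z) @ \oo --> a y z} ->
  (fun N => pfword (a_ N) n w) @ \oo --> pfword a n w.
Proof.
elim: n w => [|n IHn] [|x w] //=; do ?by move=> *; apply: cvg_cst.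
move=> /andP[/allP xw rw] aP; apply: cvg_wcontract => [z zw | v vw].
  by apply: aP; rewrite ?mem_head ?inE ?zw ?orbT //; apply: xw.
apply: IHn; first exact: subseq_pairwise vw rw.
by move=> y z /(mem_subseq vw) yw /(mem_subseq vw) zw; apply: aP;
  rewrite inE ?yw ?zw orbT.
Qed.

End PfwordContinuity.

Section ZetaLimit.
Local Open Scope classical_set_scope.
Variables (R : realType) (D : nat) (a : nat -> R[i]).

(** The zeta function restricted to tableaux with entries at most N, on shapes padded
with empty rows. *)
Definition trunc_zeta (lam mu : seq nat) (N : nat) : R[i] :=
  growth (time_content D)
    (fun t => npow (mark_abs (time_mark D t)) (- a (time_content D t)))
    mu (N.*2 * D)%N lam.

Lemma cvg_zetaQ (lam mu : seq nat) (o : nat) (lam' mu' : seq nat)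
    (s : ST lam mu R[i]) :
    (forall i, (i < size lam)%N -> nth 0%N lam' i = (o + nth 0 lam i)%N) ->
    (forall i, (i < size lam)%N -> nth 0%N mu' i = (o + nth 0 mu i)%N) ->
    padded_strict lam' -> padded_strict mu' ->
    size lam' = size lam -> size mu' = size lam ->
    (forall i, (nth 0 mu i <= nth 0 lam i)%N) ->
    (forall i, (nth 0 lam' i <= D)%N) -> (0 < D)%N ->
    (forall b, s b = a (o + box_diag b)%N) -> zetaQ_abscvg s ->
  trunc_zeta lam' mu' @ \oo --> (zetaQ s : R[i]^o).
Proof.
move=> lam'E mu'E lam'P mu'P size_lam' size_mu' sub_mu lam'D D0 sE sabs.
have [A AP] := choice (fun N => sum_QSST_growth N lam'E mu'E lam'D D0 sub_mu
  (fun d k => npow k (- a d)) lam'P mu'P size_lam' size_mu').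
rewrite (_ : trunc_zeta lam' mu' = (fun N => \sum_(M <- A N) zetaQ_term s M)).
  apply: abscvg_partial_sum_cvg => // M.
  exists (\max_(b : SDskew lam mu) (val M b).1.+1)%N => N NN.
  have [-> _] := AP N; apply/forallP => b; apply: leq_trans NN.
  exact: (leq_bigmax b).
apply/funext => N; rewrite /trunc_zeta; have [_ <-] := AP N; apply: eq_bigr => M _.
by apply: eq_bigr => b _; rewrite sE.
Qed.

End ZetaLimit.

Lemma padded_strict_cat0 mu k : strict_partition mu -> padded_strict (mu ++ nseq k 0%N).
Proof.
rewrite /strict_partition sorted_pairwise => [muP|x y z /=]; last by lia.
rewrite /padded_strict pairwise_cat; apply/and3P; split.
- by apply/allrelP => x y _ /nseqP[-> _].
- by apply: sub_pairwise muP => x y /= ->; rewrite orbT.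
- by elim: k => //= k ->; rewrite andbT; apply/allP => y /nseqP[-> _].
Qed.

Lemma strict_partition_padded lam : strict_partition lam -> padded_strict lam.
Proof. by move=> lamP; rewrite -[lam]cats0; apply: (@padded_strict_cat0 _ 0). Qed.

Section Containment.
Variables (lam mu : seq nat).
Hypothesis sub_SD : (SD mu `<=` SD lam)%fset.

Lemma SD_sub_nth i : (nth 0 mu i <= nth 0 lam i)%N.
Proof.
have [->//|mui] := posnP (nth 0%N mu i).
have imu : (i < size mu)%N by rewrite ltnNge; apply: contraL mui => /(nth_default 0%N)->.
have := fsubsetP sub_SD (i.+1, nth 0 mu i + i)%N; rewrite !mem_SD /=; lia.
Qed.

Lemma SD_sub_size : all (leq 1) mu -> (size mu <= size lam)%N.
Proof.
move=> mu0; case: (posnP (size mu)) => [->//|size_mu].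
have lastlt : ((size mu).-1 < size mu)%N by lia.
have := SD_sub_nth (size mu).-1; have := allP mu0 _ (mem_nth 0%N lastlt).
rewrite /= => mu1 le; rewrite leqNgt; apply/negP => lt.
by move: le; rewrite (nth_default _ (_ : size lam <= _)%N); lia.
Qed.

End Containment.

Section RowTableaux.
Variables (R : realType) (r l : nat) (lam : r.-tuple nat) (mu : l.-tuple nat).
Variable a : nat -> R[i].

Lemma box_diag_lt_size (rows : seq (seq R[i])) (b : SDskew (map size rows) [::]) :
  (box_diag b < size (nth [::] rows (box_row b).-1))%N.
Proof.
have := boxP b; rewrite size_map => /and3P[/andP[r1 r2] _ /andP[_]].
by rewrite (nth_map [::]) //; lia.
Qed.

Lemma nth_row_from (i : 'I_r) m d : (d < size (row_from lam a i (i.+1 + m)))%N ->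
  nth 0 (row_from lam a i (i.+1 + m)) d = a (m + d)%N.
Proof.
rewrite size_map => dlt; rewrite (nth_map 0%N) // nth_iota.
  by congr a; lia.
by move: dlt; rewrite size_iota.
Qed.

Lemma nth_row_from0 (i : 'I_r) d : (d < size (row_from lam a i i.+1))%N ->
  nth 0 (row_from lam a i i.+1) d = a d.
Proof. by have := @nth_row_from i 0 d; rewrite addn0. Qed.

Lemma pair_tableauE (i j : 'I_r) b : pair_tableau lam a i j b = a (0 + box_diag b)%N.
Proof.
have := box_diag_lt_size b; rewrite ffunE -/(box_row b) -/(box_col b) -/(box_diag b).
case: (box_row b).-1 => [|[|k]] /= blt.
- exact: nth_row_from0.
- exact: nth_row_from0.
- by rewrite nth_nil in blt.
Qed.

Lemma tail_tableauE (i : 'I_r) (j : 'I_l) b :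
  tail_tableau lam mu a i j b = a (mu_rev mu j + box_diag b)%N.
Proof.
have := box_diag_lt_size b; rewrite ffunE -/(box_row b) -/(box_col b) -/(box_diag b).
by case: (box_row b).-1 => [|k] /= blt; [apply: nth_row_from | rewrite nth_nil in blt].
Qed.

End RowTableaux.

Theorem theorem4p4 (R : realType) (r l n : nat)
    (lam : r.-tuple nat) (mu : l.-tuple nat)
    (hlam : strict_partition lam)
    (hmu : strict_partition mu) (hmu_pos : all (fun m => 0 < m)%N mu)
    (hle : (SD mu `<=` SD lam)%fset)
    (hn : (r + l)%N = n.*2)
    (a : nat -> R[i]) (s : ST lam mu R[i]) (hs : diag_with a s)
    (habs : zetaQ_abscvg s)
    (habs_a : forall i j : 'I_r, (i < j)%N ->
        zetaQ_abscvg (pair_tableau lam a i j))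
    (habs_b : forall (i : 'I_r) (j : 'I_l), (mu_rev mu j < tnth lam i)%N ->
        zetaQ_abscvg (tail_tableau lam mu a i j)) :
  zetaQ s = pf (castmx (hn, hn) (block_mx (M_mx lam a) (H_mx lam mu a) 0 0)).
Proof.
pose D := (\max_(p <- lam) p).+1.
have lamD i : (nth 0 lam i <= D)%N.
  have [ilam | lami] := ltnP i (size lam); last by rewrite nth_default.
  by apply/leqW/leq_bigmax_seq => //; apply: mem_nth.
have size_le : (size mu <= size lam)%N := SD_sub_size hle hmu_pos.
have lamP := strict_partition_padded hlam.
have lhs : (trunc_zeta D a lam (mu ++ nseq (size lam - size mu) 0%N) @ \oo
    --> (zetaQ s : R[i]^o))%classic.
  apply: (@cvg_zetaQ _ _ _ lam mu 0%N) => //.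
  - by move=> i _; rewrite nth_cat nth_nseq if_same; case: ltnP => // /(nth_default _)->.
  - exact: padded_strict_cat0.
  - by rewrite size_cat size_nseq subnKC.
  - exact: SD_sub_nth.
apply: (@norm_cvg_unique _ (R[i]^o) _ _ _ _ lhs).
pose entry_ N := entry (time_content D)
  (fun t => npow (mark_abs (time_mark D t)) (- a (time_content D t))) (N.*2 * D).
pose w := word lam mu.
pose letter (i : 'I_n.*2) := nth (inl 0%N) w i.
have size_w : size w = n.*2 by rewrite size_cat !size_map size_rev !size_tuple.
have wE : map letter (enum 'I_n.*2) = w.
  by rewrite map_comp val_enum_ord -size_w -/(mkseq _ _) mkseq_nth.
have enum_lt : pairwise (fun i j : 'I_n.*2 => (i < j)%N) (enum 'I_n.*2).
  by rewrite -(pairwise_map val ltn) val_enum_ord -sorted_pairwise ?iota_ltn_sorted //; apply: ltn_trans.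
rewrite (_ : trunc_zeta _ _ _ _ =
  fun N => pfword (fun i j => entry_ N (letter i) (letter j)) n (enum 'I_n.*2)).
  rewrite pf_pfword; apply: (cvg_pfword enum_lt) => i j _ _ ij.
  rewrite castmxE /= /letter /w /word.
  have nth_lam (k : 'I_r) : nth (inl 0%N) (map inl lam ++ map inr (rev mu)) k = inl (tnth lam k).
    by rewrite nth_cat size_map size_tuple ltn_ord (nth_map 0%N) ?size_tuple // (tnth_nth 0%N).
  have nth_mu (k : 'I_l) : nth (inl 0%N) (map inl lam ++ map inr (rev mu)) (r + k) = inr (mu_rev mu k).
    rewrite nth_cat size_map size_tuple ltnNge leq_addr /= addKn.
    rewrite (nth_map 0%N) ?size_rev ?size_tuple // nth_rev ?size_tuple //.
    by rewrite /mu_rev (tnth_nth 0%N).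
  (* The first letter of a pair is a row of mu: then so is the second one. *)
  case: (split_ordP (cast_ord (esym hn) i)) => i' iE; last first.
    have jE : exists j', cast_ord (esym hn) j = rshift r j'.
      case: (split_ordP (cast_ord (esym hn) j)) => j' jE; last by exists j'.
      have := congr1 val iE; have := congr1 val jE; rewrite /= => jv iv.
      by move: ij (ltn_ord j'); rewrite jv iv; lia.
    case: jE => j' jE; rewrite iE jE block_mxEdr mxE.
    have iE' : i = (r + i')%N :> nat by have := congr1 val iE.
    rewrite iE' nth_mu (_ : (fun N => _) = fun=> 0) //.
    exact: (@cvg_cst (R[i]^o)).
  rewrite iE.
  have iE' : i = i' :> nat by have := congr1 val iE.
  rewrite iE' nth_lam.
  case: (split_ordP (cast_ord (esym hn) j)) => j' jE; rewrite jE; last first.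
    have jE' : j = (r + j')%N :> nat by have := congr1 val jE.
    rewrite jE' nth_mu block_mxEur mxE.
    case: ltngtP => [lt|gt|->].
    - rewrite (_ : (fun N => _) = fun=> 0); first exact: (@cvg_cst (R[i]^o)).
      by apply/funext => N; apply: growth_lt.
    - apply: (@cvg_zetaQ _ _ _ _ [::] (mu_rev mu j') [:: tnth lam i'] [:: mu_rev mu j']) => //.
      + by move=> k; rewrite shape_tail_tableau; case: k => //= _; rewrite subnKC // ltnW.
      + by case=> //= _; rewrite addn0.
      + by move=> k; rewrite nth_nil.
      + by case=> [|k] /=; rewrite ?nth_nil // (tnth_nth 0%N) lamD.
      + by move=> b; apply: tail_tableauE.
      + exact: habs_b.
    - rewrite (_ : (fun N => _) = fun=> 1); first exact: (@cvg_cst (R[i]^o)).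
      by apply/funext => N; apply: growth_refl.
  have jE' : j = j' :> nat by have := congr1 val jE.
  rewrite jE' nth_lam block_mxEul mxE.
  have i'j' : (i' < j')%N by rewrite -iE' -jE'.
  rewrite i'j'.
  have lt_lam : (tnth lam j' < tnth lam i')%N.
    have sorted_nth := sorted_ltn_nth (rev_trans ltn_trans) 0%N hlam.
    by rewrite !(tnth_nth 0%N); apply: sorted_nth; rewrite ?inE ?size_tuple.
  rewrite (_ : (fun N => _) = trunc_zeta D a [:: tnth lam i'; tnth lam j'] [:: 0%N; 0%N]).
    apply: (@cvg_zetaQ _ _ _ _ [::] 0%N) => //.
    + by move=> k _; rewrite shape_pair_tableau.
    + by case=> [|[|k]].
    + by rewrite /padded_strict /= lt_lam orbT.
    + by move=> k; rewrite nth_nil.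
    + by case=> [|[|k]] /=; rewrite ?nth_nil // (tnth_nth 0%N) lamD.
    + by move=> b; apply: pair_tableauE.
    + exact: habs_a.
  by apply/funext => N; rewrite /entry_ /= lt_lam orbT.
apply/funext => N; rewrite /trunc_zeta (@growth_pfword _ _ _ _ n) ?size_tuple //;
  last by move: size_le; rewrite !size_tuple.
by rewrite -/w -wE; apply/esym/(pfword_map _ enum_lt).
Qed.
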